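(* Let $n\ge 1$, $D>0$, $A\in\mathbb{R}^{n\times n}$, $B\in\mathbb{R}^{n\times 1}$ with $(A,B)$ controllable, let $K\in\mathbb{R}^{1\times n}$ be such that $A+BK$ is Hurwitz, and let $N\in\mathbb{N}$ with $N>1$. Let $K_1\in\mathbb{R}^{1\times N}$, $K_2\in\mathbb{R}^{1\times n}$, $\tilde A_d\in\mathbb{R}^{N\times N}$, $\tilde B_d\in\mathbb{R}^{N\times n}$ be the controller matrices defined in the context from $A,B,K,D,N$. For an integer $l\ge 1$, a symmetric matrix $P\in\mathbb{R}^{(n+N+l)\times(n+N+l)}$ and a scalar $\alpha\in\mathbb{R}$, let $\Lambda=\Lambda(l,P,\alpha)$ be the symmetric matrix of size $n+N+l+1$ defined in the context. If there exist an integer $l\ge 1$, a symmetric matrix $P\in\mathbb{R}^{(n+N+l)\times(n+N+l)}$ and a scalar $\alpha$ such that $$P>0,\qquad \alpha>0,\qquad \Lambda<0$$ (positive, respectively negative, definiteness for matrices), then the closed-loop ODE--PDE system $$\begin{cases}\dot X(t)=AX(t)+Bu(0,t),\\ \dfrac{\partial u}{\partial t}(\zeta,t)=\dfrac{\partial u}{\partial \zeta}(\zeta,t),\quad \zeta\in[0,D],\\ u(D,t)=K_1\hat u_d(t)+K_2X(t),\\ \dot{\hat u}_d(t)=\tilde A_d\hat u_d(t)+\tilde B_dX(t),\end{cases}$$ with state $X(t)\in\mathbb{R}^n$, $\hat u_d(t)\in\mathbb{R}^N$, $u(\cdot,t):[0,D]\to\mathbb{R}$, is asymptotically stable.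
   Context: **Origin of the system.** The closed loop is the interconnection of the input-delay plant $\dot X(t)=AX(t)+BU(t-D)$, $U(t)\in\mathbb{R}$, with the dynamic controller $\dot{\hat u}_d=\tilde A_d\hat u_d+\tilde B_dX$, $U=K_1\hat u_d+K_2X$. The plant is written equivalently as $\dot X(t)=AX(t)+Bu(0,t)$, $\partial_t u=\partial_\zeta u$ on $[0,D]$, $u(D,t)=U(t)$, with initial data $X(0)=X_0$, $u(\zeta,0)=u_0(\zeta)$. **Stability notion.** The state is $(X,\hat u_d,u)\in\mathbb{R}^n\times\mathbb{R}^N\times L^2(0,D)$ with norm squared $|X|^2+|\hat u_d|^2+\int_0^D u(\zeta)^2\,d\zeta$. ''Asymptotically stable'' means that the zero equilibrium is Lyapunov stable and attractive in this norm. **Basis functions and discretization matrices.** Let $h=D/(N-1)$. Let $\phi=(\phi_1,\dots,\phi_N)^\top$ be the vector of equidistant piecewise linear (hat) functions on $[0,D]$: - $\phi_1(\zeta)=-\tfrac1h(\zeta-h)$ on $[0,h]$ and $0$ elsewhere; - for $2\le j\le N-1$, $\phi_j(\zeta)=\tfrac1h(\zeta-(j-2)h)$ on $[(j-2)h,(j-1)h]$, $\phi_j(\zeta)=-\tfrac1h(\zeta-jh)$ on $[(j-1)h,jh]$, and $0$ elsewhere; - $\phi_N(\zeta)=\tfrac1h(\zeta-(N-2)h)$ on $[(N-2)h,(N-1)h]$ and $0$ elsewhere. Define $$E_d=\int_0^D\phi\phi^\top d\zeta,\quad A_d=-\int_0^D\frac{\partial\phi}{\partial\zeta}\phi^\top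 d\zeta-\phi(0)\phi(0)^\top,\quad B_d=\phi(D).$$ Explicitly: - $E_d$ is $\tfrac h6$ times the symmetric tridiagonal $N\times N$ matrix with diagonal $(2,4,\dots,4,2)$ and off-diagonal entries $1$; - $A_d$ is $\tfrac12$ times the tridiagonal $N\times N$ matrix with diagonal $(-1,0,\dots,0,-1)$, superdiagonal entries $1$ and subdiagonal entries $-1$; - $B_d=(0,\dots,0,1)^\top\in\mathbb{R}^{N\times1}$. **Controller matrices.** $$K_1=\int_0^D Ke^{A(D-\zeta)}B\,\phi^\top(\zeta)\,d\zeta,\quad K_2=Ke^{AD},\quad \tilde A_d=E_d^{-1}(A_d+B_dK_1),\quad \tilde B_d=E_d^{-1}B_dK_2.$$ **LMI matrices.** For an integer $l\ge1$, index rows and columns of $l$-dimensional objects by $k,i\in\{0,\dots,l-1\}$. - $M\in\mathbb{R}^{l\times l}$ is strictly lower triangular with $M_{k,i}=(2i+1)\bigl(1-(-1)^{k+i}\bigr)$ for $i<k$ and $M_{k,i}=0$ for $i\ge k$. - $L(D)=(1,1,1,\dots)^\top\in\mathbb{R}^{l}$ and $L(0)=(1,-1,1,-1,\dots)^\top\in\mathbb{R}^{l}$, i.e. $L(0)_k=(-1)^k$. - $Q=\mathrm{diag}(1,3,5,\dots,2l-1)\in\mathbb{R}^{l\times l}$. With block partition of sizes $n,N,l$, $$\bar K=\begin{bmatrix}K_2&K_1&0_{1\times l}\end{bmatrix},\quad \mathcal A=\begin{bmatrix}A&0&0\\ \tilde B_d&\tilde A_d&0\\0&0&-\tfrac1DM\end{bmatrix},\quad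 \mathcal B_1=\begin{bmatrix}0_{n\times1}\\0_{N\times1}\\L(D)\end{bmatrix},\quad \mathcal B_2=\begin{bmatrix}B\\0_{N\times1}\\-L(0)\end{bmatrix},\quad \bar Q=\begin{bmatrix}0&0&0\\0&0&0\\0&0&Q\end{bmatrix},$$ $$\Psi=\mathcal A^\top P+P\mathcal A+\alpha(1+D)\bar K^\top\bar K-\tfrac{\alpha}{D}\bar Q+P\mathcal B_1\bar K+\bar K^\top\mathcal B_1^\top P,\qquad \Lambda=\begin{bmatrix}\Psi&P\mathcal B_2\\ \mathcal B_2^\top P&-\alpha\end{bmatrix}.$$ *)

(* Defs.v *)
From mathcomp Require Import all_boot all_order all_algebra.
From mathcomp Require Import complex.
From mathcomp Require Import all_classical all_reals all_analysis.
Set Implicit Arguments.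
Unset Strict Implicit.
Unset Printing Implicit Defensive.
Import Order.TTheory GRing.Theory Num.Theory.
Import numFieldNormedType.Exports.
Local Open Scope classical_set_scope.
Local Open Scope ring_scope.

Section Matrices.
Context {R : realType}.

(* Every complex eigenvalue has negative real part. *)
Definition hurwitz (n : nat) (A : 'M[R]_n) : Prop :=
  forall z : R[i],
    eigenvalue (map_mx (fun x : R => real_complex R x) A) z -> complex.Re z < 0.

(* Entrywise sum of the exponential series. *)
Definition expmx (n : nat) (A : 'M[R]_n) : 'M[R]_n :=
  \matrix_(i, j) limn (series (fun k : nat => (A ^+ k) i j / k`!%:R)).

Definition posdef (m : nat) (S : 'M[R]_m) : Prop :=
  forall x : 'cV[R]_m, x != 0 -> 0 < (x^T *m S *m x) 0 0.

Definition negdef (m : nat) (S : 'M[R]_m) : Prop :=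
  forall x : 'cV[R]_m, x != 0 -> (x^T *m S *m x) 0 0 < 0.

End Matrices.

Section Plant.
Context {R : realType}.
Local Notation mu := (@lebesgue_measure R).

(* X' = A X + B v on [0, T] in the sense of Caratheodory: X is absolutely
   continuous and the equation holds almost everywhere, i.e. X satisfies the
   integrated equation.  The input v need only be integrable. *)
Definition plant_trajectory (n : nat) (A : 'M[R]_n) (B : 'cV[R]_n) (T : R)
    (v : R -> R) (X : R -> 'cV[R]_n) : Prop :=
  [/\ mu.-integrable `[0, T] (EFin \o v),
      forall i, {within `[0, T], continuous (fun t : R => X t i 0)} &
      forall (t : R) i, 0 <= t <= T ->
        X t i 0 =
        X 0 i 0 + \int[mu]_(s in `[0, t]) (A *m X s + v s *: B) i 0].

Definition controllable (n : nat) (A : 'M[R]_n) (B : 'cV[R]_n) : Prop :=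
  forall x0 x1 : 'cV[R]_n, exists (T : R) (v : R -> R) (X : R -> 'cV[R]_n),
    [/\ 0 < T, plant_trajectory A B T v X, X 0 = x0 & X T = x1].

End Plant.

Section Controller.
Context {R : realType}.
Local Notation mu := (@lebesgue_measure R).
Variables (n : nat) (A : 'M[R]_n) (B : 'cV[R]_n) (K : 'rV[R]_n).
Variables (D : R) (N : nat).

Definition mesh : R := D / N.-1%:R.

(* Indices start at 0, so hat j peaks at the node j * mesh; it is extended by 0
   outside [0, D]. *)
Definition hat (j : 'I_N) (z : R) : R :=
  if (0 < j)%N && (j.-1%:R * mesh <= z <= j%:R * mesh) then
    (z - j.-1%:R * mesh) / mesh
  else if (j < N.-1)%N && (j%:R * mesh <= z <= j.+1%:R * mesh) then
    - (z - j.+1%:R * mesh) / mesh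
  else 0.

Definition Ed : 'M[R]_N :=
  \matrix_(i, j) \int[mu]_(z in `[0, D]) (hat i z * hat j z).

(* derive1 is meaningless at the finitely many nodes, which are negligible. *)
Definition Ad : 'M[R]_N :=
  \matrix_(i, j) (- (\int[mu]_(z in `[0, D]) (derive1 (hat i) z * hat j z))
                  - hat i 0 * hat j 0).

Definition Bd : 'cV[R]_N := \col_j hat j D.

Definition K1 : 'rV[R]_N :=
  \row_j \int[mu]_(z in `[0, D])
    ((K *m expmx ((D - z) *: A) *m B) 0 0 * hat j z).

Definition K2 : 'rV[R]_n := K *m expmx (D *: A).

Definition tAd : 'M[R]_N := invmx Ed *m (Ad + Bd *m K1).

Definition tBd : 'M[R]_(N, n) := invmx Ed *m (Bd *m K2).

End Controller.

Section LMI.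
Context {R : realType}.
Variables (n : nat) (A : 'M[R]_n) (B : 'cV[R]_n) (K : 'rV[R]_n).
Variables (D : R) (N l : nat).

Definition legM : 'M[R]_l :=
  \matrix_(k, i) (if (i < k)%N then
                    (2 * i + 1)%:R * (1 - (-1) ^+ (k + i)) else 0).

Definition legLD : 'cV[R]_l := const_mx 1.

Definition legL0 : 'cV[R]_l := \col_k (-1) ^+ k.

Definition legQ : 'M[R]_l := diag_mx (\row_k (2 * k + 1)%:R).

Definition Kbar : 'rV[R]_(n + N + l) :=
  row_mx (row_mx (K2 A K D) (K1 A B K D N)) 0.

Definition calA : 'M[R]_(n + N + l) :=
  block_mx (block_mx A 0 (tBd A K D N) (tAd A B K D N)) 0
           0 (- (D^-1 *: legM)).

Definition calB1 : 'cV[R]_(n + N + l) := col_mx (col_mx 0 0) legLD.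

Definition calB2 : 'cV[R]_(n + N + l) := col_mx (col_mx B 0) (- legL0).

Definition Qbar : 'M[R]_(n + N + l) := block_mx 0 0 0 legQ.

Definition Psi (P : 'M[R]_(n + N + l)) (alpha : R) : 'M[R]_(n + N + l) :=
  calA^T *m P + P *m calA + (alpha * (1 + D)) *: (Kbar^T *m Kbar)
  - (alpha / D) *: Qbar + P *m calB1 *m Kbar + Kbar^T *m calB1^T *m P.

Definition Lambda (P : 'M[R]_(n + N + l)) (alpha : R) :
    'M[R]_(n + N + l + 1) :=
  block_mx (Psi P alpha) (P *m calB2) (calB2^T *m P) (- alpha)%:M.

End LMI.

Section ClosedLoop.
Context {R : realType}.
Local Notation mu := (@lebesgue_measure R).
Variables (n : nat) (A : 'M[R]_n) (B : 'cV[R]_n) (K : 'rV[R]_n).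
Variables (D : R) (N : nat).

Definition in_L2 (w : R -> R) : Prop :=
  measurable_fun `[0, D] w /\
  mu.-integrable `[0, D] (fun z => (w z ^+ 2)%:E).

Definition state_norm (x : 'cV[R]_n) (uh : 'cV[R]_N) (w : R -> R) : R :=
  Num.sqrt (\sum_i x i 0 ^+ 2 + \sum_j uh j 0 ^+ 2
            + \int[mu]_(z in `[0, D]) (w z ^+ 2)).

(* Global-in-time solutions with state in R^n x R^N x L^2(0, D); u z t is the
   value at position z and time t, and the initial datum is the value at t = 0.
   As u need not be differentiable, u_t = u_z is required in integrated form on
   each rectangle [a, b] x [0, t].  This fixes the time traces u a almost
   everywhere, in particular those at a = 0 and a = D that couple the transport
   equation to the two ODEs. *)
Record closed_loop_solution (X : R -> 'cV[R]_n) (uh : R -> 'cV[R]_N)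
    (u : R -> R -> R) : Prop := ClosedLoopSolution {
  sol_L2 : forall t : R, 0 <= t -> in_L2 (fun z => u z t);
  sol_trace : forall z T : R, 0 <= z <= D -> 0 <= T ->
    mu.-integrable `[0, T] (fun t => (u z t)%:E);
  sol_joint : forall T : R, 0 <= T ->
    (mu \x mu)%E.-integrable (`[0, D] `*` `[0, T])
      (fun zt : R * R => (u zt.1 zt.2)%:E);
  sol_plant : forall T : R, 0 <= T -> plant_trajectory A B T (u 0) X;
  sol_transport : forall a b t : R, 0 <= a -> a <= b -> b <= D -> 0 <= t ->
    \int[mu]_(z in `[a, b]) u z t - \int[mu]_(z in `[a, b]) u z 0 =
    \int[mu]_(s in `[0, t]) u b s - \int[mu]_(s in `[0, t]) u a s;
  sol_boundary : {ae mu, forall t : R, 0 <= t ->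
    u D t = (K1 A B K D N *m uh t + K2 A K D *m X t) 0 0};
  sol_controller_cont : forall j,
    {within `[0, +oo[, continuous (fun t : R => uh t j 0)};
  sol_controller : forall (t : R) j, 0 < t ->
    is_derive t (1 : R) (fun s : R => uh s j 0)
      ((tAd A B K D N *m uh t + tBd A K D N *m X t) j 0)
}.

(* By linearity, attractivity is the same locally and globally; it is stated
   for all initial data. *)
Definition asymptotically_stable : Prop :=
  (forall eps : R, 0 < eps -> exists2 delta : R, 0 < delta &
     forall X uh u, closed_loop_solution X uh u ->
       state_norm (X 0) (uh 0) (fun z => u z 0) < delta ->
       forall t : R, 0 <= t ->
         state_norm (X t) (uh t) (fun z => u z t) < eps) /\
  (forall X uh u, closed_loop_solution X uh u ->
     state_norm (X t) (uh t) (fun z => u z t) @[t --> +oo%R] --> (0 : R)).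

End ClosedLoop.

(* Main.v *)
(* The transport equation is solved along characteristics: the primitive of u
   along [0, z] x {0} and then {z} x [0, t] depends on z + t only, so that u(z, t)
   is g(z + t), where g is the initial profile followed by the boundary input
   delayed by D.  On [0, D] a Gronwall estimate bounds the state by its initial
   value.  After time D the profile is continuous in time, and V = P[X, uh, U] +
   alpha * int (1 + z) u^2, with U the first l Legendre moments of the profile,
   is differentiable: by Bonnet's identities the derivative of U is governed by
   legM, legLD and legL0, and by Bessel's inequality the derivative of V is at
   most the quadratic form Lambda at (X, uh, U, u(0, t)).  Hence V decays
   exponentially, and V is equivalent to the squared norm of the state. *)
From HB Require Import structures.
Require Import Defs.
From mathcomp Require Import all_boot all_order all_algebra.
From mathcomp Require Import all_classical all_reals all_analysis.
From mathcomp Require Import measurable_realfun.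
From mathcomp Require Import ring lra zify.
Import Order.TTheory GRing.Theory Num.Theory.
Import numFieldNormedType.Exports.
Local Open Scope ring_scope.

(** * Integrals over intervals *)

Section IntervalIntegrals.
Context {R : realType}.
Local Notation mu := (@lebesgue_measure R).
Local Open Scope classical_set_scope.
Implicit Types (f g : R -> R) (a b c : R).

(** The split at time [D] is forced by regularity. Until then the plant is driven by the initial
    profile, which is merely square integrable, so [X] is only absolutely continuous and V need not
    be differentiable. Afterwards the outflow is the feedback of [D] time units earlier; it is
    continuous because [X] and [uh] are, so [X] becomes differentiable. The early estimate shows no
    decay and is paid for by a factor [expR (c * D)]. No chain rule along characteristics is
    available: [u] has no derivatives, and its potential is known only to be continuous in each
    variable separately. Constancy of the potential is therefore extracted from Fubini's theorem on
    triangles. The weight 1 + z dictates the shape of Lambda: transport turns the derivative of int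
    (1 + z) u^2 into (1 + D) u(D,t)^2 - u(0,t)^2 - int u^2. Times alpha, the first term is the Kbar
    block, the second is the corner - alpha, and Bessel's inequality compares the third with the
    Qbar block. Lambda sees only l moments of the profile, whereas decay is needed in the whole L^2
    norm; the strictness of Lambda < 0 bridges this gap. *)

Lemma lebesgue_measure_reflect c (S : set R) : measurable S ->
  pushforward mu (fun x : measurableTypeR R => (c - x : measurableTypeR R)) S = mu S.
Proof.
move=> mS; apply/esym.
have mphi : measurable_fun setT
    (fun x : measurableTypeR R => (c - x : measurableTypeR R)).
  by apply: measurable_funB.
pose phi : {mfun measurableTypeR R >-> measurableTypeR R} :=
  HB.pack (fun x : measurableTypeR R => (c - x : measurableTypeR R))
   (isMeasurableFun.Build _ _ _ _ _ mphi).
(* It is enough to test half-open intervals. Reflection moves the closed end to the other side,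
   which does not change the measure. *)
apply: (@lebesgue_measure_unique R (pushforward mu phi)) => // _ [[a b]] _ <-.
rewrite [RHS]/= /pushforward.
rewrite (_ : phi @^-1` _ = `[c - b, c - a[%classic); last first.
  apply/seteqP; split => x /=; rewrite !in_itv/= => /andP[? ?]; apply/andP; split; lra.
rewrite !lebesgue_measure_itv/= !lte_fin; have -> : (c - b < c - a) = (a < b) by lra.
by case: ifP => // _; rewrite -!EFinB; congr (_%:E); lra.
Qed.

Lemma integral_reflect c (f : R -> \bar R) :
  measurable_fun setT f -> mu.-integrable setT (fun x => f (c - x)) ->
  (\int[mu]_x f (c - x)%R = \int[mu]_x f x)%E.
Proof.
move=> mf fi.
have mphi : measurable_fun setT
    (fun x : measurableTypeR R => (c - x : measurableTypeR R)).
  by apply: measurable_funB.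
have := @integral_pushforward _ _ _ _ R
  (fun x : measurableTypeR R => (c - x : measurableTypeR R)) mphi mu setT f mf.
rewrite preimage_setT => /(_ fi measurableT) <-.
by apply: eq_measure_integral => S mS _; exact: lebesgue_measure_reflect.
Qed.

Lemma integrable_reflect c (f : R -> \bar R) :
  mu.-integrable setT f -> mu.-integrable setT (fun x => f (c - x)).
Proof.
move=> /integrableP[mf fi].
have mphi : measurable_fun setT
    (fun x : measurableTypeR R => (c - x : measurableTypeR R)).
  by apply: measurable_funB.
apply/integrableP; split; first exact: (measurableT_comp mf mphi).
have := @ge0_integral_pushforward _ _ _ _ R
  (fun x : measurableTypeR R => (c - x : measurableTypeR R)) mphi mu setT (abse \o f) measurableT.
rewrite preimage_setT => /= H; rewrite -H.
- rewrite (eq_measure_integral mu)// => S mS _; exact: lebesgue_measure_reflect.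
- by apply: measurableT_comp => //; exact: mf.
- by move=> *; exact: abse_ge0.
Qed.

Lemma restrict_reflect c a b f :
  (fun x => (f \_ `[c - b, c - a]) (c - x)) = (fun x => f (c - x)) \_ `[a, b].
Proof.
apply/funext => x; rewrite !patchE.
have -> // : (c - x \in `[c - b, c - a]) = (x \in `[a, b]).
by apply/idP/idP; rewrite !inE/= !in_itv/= => /andP[? ?]; apply/andP; split; lra.
Qed.

Lemma integrable_itv_reflect c a b f :
  mu.-integrable `[c - b, c - a] (EFin \o f) ->
  mu.-integrable `[a, b] (EFin \o (fun x => f (c - x))).
Proof.
move=> fi; apply/integrable_mkcond => //; rewrite restrict_EFin -restrict_reflect.
move: fi => /integrable_mkcond; rewrite restrict_EFin => /(_ (measurable_itv _)).
exact: integrable_reflect.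
Qed.

Lemma Rintegral_reflect c a b f :
  mu.-integrable `[c - b, c - a] (EFin \o f) ->
  \int[mu]_(x in `[a, b]) f (c - x) = \int[mu]_(x in `[c - b, c - a]) f x.
Proof.
move=> fi; rewrite Rintegral_mkcond [RHS]Rintegral_mkcond -restrict_reflect.
move: fi => /integrable_mkcond; rewrite restrict_EFin => /(_ (measurable_itv _)) fi.
rewrite /Rintegral; congr fine; apply: (integral_reflect c (EFin \o (f \_ `[c - b, c - a]))).
  exact: measurable_int fi.
exact: (integrable_reflect c _ fi).
Qed.

(** A translation is a composite of two reflections, so reflections are the only change of variables
    that needs measure theory; they also exchange space and time along a line z + t = c. *)
Lemma integrable_itv_shift t a b f :
  mu.-integrable `[a + t, b + t] (EFin \o f) ->
  mu.-integrable `[a, b] (EFin \o (fun x => f (x + t))).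
Proof.
move=> fi; have -> : (fun x => f (x + t)) = (fun x => f (t - (0 - x))).
  by apply/funext => x; congr f; lra.
apply: (@integrable_itv_reflect 0 a b (fun y => f (t - y))).
by apply: integrable_itv_reflect; rewrite !sub0r !opprK addrC [t + b]addrC.
Qed.

Lemma Rintegral_shift t a b f :
  mu.-integrable `[a + t, b + t] (EFin \o f) ->
  \int[mu]_(x in `[a, b]) f (x + t) = \int[mu]_(x in `[a + t, b + t]) f x.
Proof.
move=> fi; have -> : (fun x => f (x + t)) = (fun x => f (t - (0 - x))).
  by apply/funext => x; congr f; lra.
have fi' : mu.-integrable `[t - (0 - a), t - (0 - b)] (EFin \o f).
  by rewrite !sub0r !opprK addrC [t + b]addrC.
rewrite (@Rintegral_reflect 0 a b (fun y => f (t - y))); last exact: integrable_itv_reflect.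
by rewrite Rintegral_reflect// !sub0r !opprK addrC [t + b]addrC.
Qed.

Lemma integrable_itvS a b a' b' f : a <= a' -> b' <= b ->
  mu.-integrable `[a, b] (EFin \o f) -> mu.-integrable `[a', b'] (EFin \o f).
Proof.
move=> aa bb; apply: integrableS => //.
by move=> x /=; rewrite !in_itv/= => /andP[? ?]; apply/andP; split; lra.
Qed.

Lemma Rintegral_itv_split a c b f : a <= c -> c <= b ->
  mu.-integrable `[a, b] (EFin \o f) ->
  \int[mu]_(x in `[a, b]) f x =
  \int[mu]_(x in `[a, c]) f x + \int[mu]_(x in `[c, b]) f x.
Proof.
move=> ac cb fi.
have := @Rintegral_itvB R f (BLeft a) (BRight b) c fi.
rewrite !bnd_simp => /(_ ac cb)/eqP; rewrite subr_eq => /eqP ->.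
rewrite Rintegral_itv_obnd_cbnd; first by rewrite addrC.
apply: integrableS fi => //; apply: subset_itvr.
by rewrite bnd_simp.
Qed.

Lemma integrable_itv_cat a c b f :
  mu.-integrable `[a, c] (EFin \o f) -> mu.-integrable `]c, b] (EFin \o f) ->
  mu.-integrable `[a, b] (EFin \o f).
Proof.
move=> /integrable_mkcond f1 /integrable_mkcond f2.
have /integrableS : mu.-integrable setT
    (((EFin \o f) \_ `[a, c]) \+ ((EFin \o f) \_ `]c, b]))%E.
  by apply: integrableD => //; [exact: f1|exact: f2].
move=> /(_ `[a, b] measurableT (measurable_itv _) (@subsetT _ _)).
apply: eq_integrable => //.
move=> x; rewrite inE/= in_itv/= => /andP[ax xb]; rewrite !patchE.
have -> : (x \in `[a, c]) = (x <= c) by apply/idP/idP; rewrite inE/= in_itv/= ax.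
have -> : (x \in `]c, b]) = (c < x) by apply/idP/idP; rewrite inE/= in_itv/= xb andbT.
by case: ltP; rewrite ?add0e ?adde0.
Qed.

Lemma Rintegral_itv_xx a f : \int[mu]_(x in `[a, a]) f x = 0.
Proof. by rewrite set_itv1 Rintegral_set1. Qed.

Lemma continuous_integrable_itv a b f : {within `[a, b], continuous f} ->
  mu.-integrable `[a, b] (EFin \o f).
Proof. by apply: continuous_compact_integrable; exact: segment_compact. Qed.

Lemma continuousT_integrable_itv a b f : continuous f ->
  mu.-integrable `[a, b] (EFin \o f).
Proof.
move=> cf; apply: continuous_integrable_itv.
by apply: continuous_subspaceT => x; exact: cf.
Qed.

Lemma is_derive_primitive a f x : continuous f -> a < x ->
  is_derive x (1 : R) (fun y => \int[mu]_(s in `[a, y]) f s) (f x).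
Proof.
move=> cf ax.
have xx1 : x < x + 1 by rewrite ltrDl.
have [d e] := continuous_FTC1_closed xx1 (continuousT_integrable_itv a (x + 1) f cf) ax (cf x).
by apply: DeriveDef d _; rewrite -derive1E.
Qed.

Lemma closed_itvoo_eq0 a b f : a < b -> {within `[a, b], continuous f} ->
  (forall x, a < x < b -> f x = 0) -> forall x, a <= x <= b -> f x = 0.
Proof.
move=> ab cf f0 x /andP[]; rewrite le_eqVlt => /predU1P[<-{x} _|ax].
  have /(continuous_within_itvP _ ab)[_ fa _] := cf.
  apply: (cvg_unique _ fa) => //.
  apply: cvg_near_cst; near=> y; rewrite f0//; apply/andP; split.
    by near: y; exact: nbhs_right_gt.
  by near: y; exact: nbhs_right_lt.
rewrite le_eqVlt => /predU1P[->|xb]; last by rewrite f0// ax xb.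
have /(continuous_within_itvP _ ab)[_ _ fb] := cf.
apply: (cvg_unique _ fb) => //.
apply: cvg_near_cst; near=> y; rewrite f0//; apply/andP; split.
  by near: y; exact: nbhs_left_gt.
by near: y; exact: nbhs_left_lt.
Unshelve. all: by end_near. Qed.

Lemma eq0_of_primitive b f : 0 < b -> {within `[0, b], continuous f} ->
  (forall h, 0 < h < b -> \int[mu]_(s in `[0, h]) f s = 0) ->
  forall x, 0 <= x <= b -> f x = 0.
Proof.
move=> b0 cf fI; apply: closed_itvoo_eq0 => // x /andP[x0 xb].
have fx : {for x, continuous f}.
  have /(continuous_within_itvP _ b0)[+ _ _] := cf.
  by apply; rewrite in_itv/= x0 xb.
have [|_ <-] := @continuous_FTC1_closed R f 0 x b xb _ x0 fx.
  exact: continuous_integrable_itv.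
rewrite derive1E (near_eq_derive (g := cst 0)) ?derive_cst//.
near=> y; rewrite fI//; apply/andP; split.
  by near: y; exact: lt_nbhsr.
by near: y; exact: lt_nbhsl.
Unshelve. all: by end_near. Qed.

(** Lebesgue differentiation. Extended by 0 outside [[a, b]], [f] has a primitive from -oo that
    vanishes identically, and the derivative of this primitive is [f] almost everywhere. *)
Lemma ae_eq0_of_primitive a b f :
  mu.-integrable `[a, b] (EFin \o f) ->
  (forall x, a <= x <= b -> \int[mu]_(s in `[a, x]) f s = 0) ->
  {ae mu, forall x, a <= x <= b -> f x = 0}.
Proof.
move=> fi fI; pose fr := f \_ `[a, b].
have fri : mu.-integrable setT (EFin \o fr).
  by move: (fi) => /integrable_mkcond; rewrite restrict_EFin; apply.
have frI y : mu.-integrable `]-oo, y] (EFin \o fr).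
  exact: (integrableS _ _ _ fri).
have := @FTC1Ny R fr frI (integrable_locally_restrict (measurable_itv _) fi).
apply: filterS; first exact: (ae_filter_ringOfSetsType mu).
move=> x + /andP[ax xb].
move=> [_].
rewrite (_ : (fun y => _) = cst 0).
  by rewrite derive1_cst /fr patchE mem_setE in_itv/= ax xb/= => <-.
apply/funext => y; rewrite -Rintegral_mkcondr.
case: (ltP y a) => ya.
  rewrite (_ : _ `&` _ = set0) ?Rintegral_set0//.
  by rewrite -subset0 => z /=; rewrite !in_itv/= => -[? /andP[? ?]]; lra.
rewrite (_ : _ `&` _ = `[a, Num.min y b]%classic).
  by apply: fI; rewrite le_min ya (le_trans ax xb) ge_min lexx orbT.
apply/seteqP; split => z /=; rewrite !in_itv/= le_min.
  by move=> [-> /andP[-> ->]].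
by move=> /and3P[-> -> ->].
Qed.

Lemma ae_eq_Rintegral_itv a b f g :
  measurable_fun `[a, b] f -> measurable_fun `[a, b] g ->
  {ae mu, forall x, a <= x <= b -> f x = g x} ->
  \int[mu]_(x in `[a, b]) f x = \int[mu]_(x in `[a, b]) g x.
Proof.
move=> mf mg fg; rewrite /Rintegral; congr fine.
apply: ae_eq_integral => //; [exact/measurable_EFinP|exact/measurable_EFinP|].
apply: filterS fg; first exact: (ae_filter_ringOfSetsType mu).
by move=> x + xab; move: xab; rewrite /= in_itv/= => xab /(_ xab) ->.
Qed.

End IntervalIntegrals.

(** * The transport equation *)

Section Characteristics.
Context {R : realType}.
Local Notation mu := (@lebesgue_measure R).
Local Open Scope classical_set_scope.
Variables (D : R) (u : R -> R -> R).
Hypothesis D_gt0 : 0 < D.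
Hypothesis profile_integrable : forall t : R, 0 <= t ->
  mu.-integrable `[0, D] (EFin \o u^~ t).
Hypothesis trace_integrable : forall z T : R, 0 <= z <= D -> 0 <= T ->
  mu.-integrable `[0, T] (EFin \o u z).
Hypothesis joint_integrable : forall T : R, 0 <= T ->
  (mu \x mu)%E.-integrable (`[0, D] `*` `[0, T])
    (fun zt : R * R => (u zt.1 zt.2)%:E).
Hypothesis transport : forall a b t : R, 0 <= a -> a <= b -> b <= D -> 0 <= t ->
  \int[mu]_(z in `[a, b]) u z t - \int[mu]_(z in `[a, b]) u z 0 =
  \int[mu]_(s in `[0, t]) u b s - \int[mu]_(s in `[0, t]) u a s.

(* A potential of the field (u, u): both of its partial derivatives are u, so
   it is a function of z + t. *)
Let F (z t : R) : R :=
  \int[mu]_(y in `[0, z]) u y 0 + \int[mu]_(s in `[0, t]) u z s.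

Let FB_time z t t' : 0 <= z <= D -> 0 <= t' -> t' <= t ->
  F z t - F z t' = \int[mu]_(s in `[t', t]) u z s.
Proof.
move=> zD t'0 t't; rewrite /F (@Rintegral_itv_split _ 0 t' t)//; first by ring.
by apply: trace_integrable => //; exact: le_trans t't.
Qed.

(** The transport equation enters here: it says that the circulation of the field (u, u) around the
    rectangle with sides [[z', z]] and [[0, t]] is zero, so the increment of [F] can be read on the
    edge at time [t]. *)
Let FB_space z z' t : 0 <= z' -> z' <= z -> z <= D -> 0 <= t ->
  F z t - F z' t = \int[mu]_(y in `[z', z]) u y t.
Proof.
move=> z'0 z'z zD t0; have := transport _ _ _ z'0 z'z zD t0.
rewrite /F (@Rintegral_itv_split _ 0 z' z)//; first by lra.
by apply: (@integrable_itvS _ 0 D) => //; exact: profile_integrable.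
Qed.

Let F_continuous_time z T : 0 <= z <= D -> 0 <= T ->
  {within `[0, T], continuous (F z)}.
Proof.
move=> zD T0 x; apply: cvgD; first exact: cvg_cst.
exact: (parameterized_integral_continuous T0 (trace_integrable _ _ zD T0)).
Qed.

Let F_continuous_space t : 0 <= t -> {within `[0, D], continuous (F^~ t)}.
Proof.
move=> t0.
(* The trace term of [F] has no evident regularity in [z]. Following the other path to the same
   point, up at 0 and then across at time [t], leaves [z] only as a bound of integration. *)
have E : {in `[0, D], (fun z => F 0 t + \int[mu]_(y in `[0, z]) u y t) =1 F^~ t}.
  move=> z; rewrite inE/= in_itv/= => /andP[z0 zD].
  by rewrite -(FB_space z 0 t)//; ring.
apply: (subspace_eq_continuous E).
move=> x; apply: cvgD; first exact: cvg_cst.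
exact: (parameterized_integral_continuous (ltW D_gt0) (profile_integrable _ t0)).
Qed.

(* Fubini over the triangle with corner (z1, t1), legs h and hypotenuse on
   z + t = z1 + t1 - h. *)
Let triangle z1 t1 h : 0 < h -> h <= z1 -> z1 <= D -> h <= t1 ->
  \int[mu]_(z in `[z1 - h, z1]) F z t1 = \int[mu]_(t in `[t1 - h, t1]) F z1 t.
Proof.
move=> h0 hz1 z1D ht1; pose c := z1 + t1 - h.
pose S := [set zt : R * R | z1 - h <= zt.1 <= z1 /\ c - zt.1 <= zt.2 <= t1].
have mS : measurable (S : set (measurableTypeR R * measurableTypeR R)%type).
  rewrite (_ : S = (`[z1 - h, z1] `*` `]-oo, t1]) `&`
     ((fun zt : R * R => zt.1 + zt.2) @^-1` `[c, +oo[)).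
    apply: measurableI; first exact: measurableX.
    rewrite -[X in measurable X]setTI.
    by apply: measurable_funD => //.
  apply/seteqP; split => -[z t] /=; rewrite !in_itv/= ?andbT.
    move=> [/andP[H1 H2] /andP[H3 H4]]; split.
      by split; [exact/andP|exact: H4].
    by rewrite addrC -lerBlDr; exact: H3.
  move=> [[H1 H2] H3]; split; [exact: H1|apply/andP; split; [|exact: H2]].
  by rewrite lerBlDr addrC; exact: H3.
have SE (z t : R) : ((z, t) \in S) = (z1 - h <= z <= z1) && (c - z <= t <= t1).
  apply/idP/andP; first by rewrite inE => -[/= -> ->].
  by move=> [H1 H2]; rewrite inE; split.
have SE' (z t : R) : t1 - h <= t <= t1 -> ((z, t) \in S) = (c - t <= z <= z1).
  rewrite SE /c => /andP[H1 H2]; apply/andP/andP => -[].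
    by move=> /andP[H3 H4] /andP[H5 H6]; split; lra.
  by move=> H3 H4; split; apply/andP; split; lra.
pose f : R * R -> \bar R := (fun zt => (u zt.1 zt.2)%:E) \_ S.
have t10 : 0 <= t1 by lra.
have fS : (mu \x mu)%E.-integrable S (fun zt : R * R => (u zt.1 zt.2)%:E).
  apply: (integrableS _ _ _ (joint_integrable _ t10)) => //; first exact: measurableX.
  move=> [z t] [/= /andP[H1 H2] /andP[H3 H4]]; rewrite !in_itv/=; split; apply/andP.
    by split; lra.
  by split => //; apply: le_trans H3; rewrite /c; lra.
have fi := (integrable_mkcond _ mS).1 fS; rewrite -/f in fi.
(* [a] is [F] along the hypotenuse. Integrating [u] over [S] in [t] first gives [F z t1 - a z]; in
   [z] first, [F z1 t - a (c - t)]. The two hypotenuse terms have equal integrals by reflection and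
   cancel. *)
pose a z := F z (c - z).
have Fz z : (\int[mu]_t f (z, t) =
    ((fun z => F z t1 - a z) \_ `[z1 - h, z1] z)%:E)%E.
  rewrite patchE mem_setE in_itv/=; case: ifPn => zI; last first.
    rewrite integral0_eq// => t _; rewrite /f patchE memNset// => -[/= zJ _].
    by rewrite zJ in zI.
  move: (zI) => /andP[zI1 zI2].
  rewrite /a FB_time; [|by apply/andP; split; lra|by rewrite /c; lra|by rewrite /c; lra].
  rewrite /Rintegral fineK; last first.
    apply: integrable_fin_num => //.
    apply: (@integrable_itvS _ 0 t1) => //; first by rewrite /c; lra.
    by apply: trace_integrable => //; apply/andP; split; lra.
  rewrite [RHS]integral_mkcond; apply: eq_integral => t _; rewrite /f !patchE.
  by rewrite mem_setE in_itv SE zI.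
have Ft t : (\int[mu]_z f (z, t) =
    ((fun t => F z1 t - a (c - t)) \_ `[t1 - h, t1] t)%:E)%E.
  rewrite patchE mem_setE in_itv/=; case: ifPn => tI; last first.
    rewrite integral0_eq// => z _; rewrite /f patchE memNset// => -[/= zJ tJ].
    move/negP: tI; apply; move: zJ tJ; rewrite /c => /andP[? ?] /andP[? ?].
    by apply/andP; split; lra.
  move: (tI) => /andP[tI1 tI2].
  rewrite /a (_ : c - (c - t) = t); last by ring.
  rewrite FB_space; [|by rewrite /c; lra..].
  rewrite /Rintegral fineK; last first.
    apply: integrable_fin_num => //.
    apply: (@integrable_itvS _ 0 D) => //; first by rewrite /c; lra.
    by apply: profile_integrable; lra.
  rewrite [RHS]integral_mkcond; apply: eq_integral => z _; rewrite /f !patchE.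
  by rewrite mem_setE in_itv SE'.
(* Separate continuity of [F] does not settle integrability along a diagonal. Fubini's theorem does:
   [a] is [F^~ t1] minus an inner integral of [f]. *)
have ia : mu.-integrable `[z1 - h, z1] (EFin \o a).
  have iFa : mu.-integrable `[z1 - h, z1] (EFin \o (fun z => F z t1 - a z)).
    apply/integrable_mkcond => //.
    apply: eq_integrable (integrable_fubini_F fi) => // z _.
    by rewrite /fubini_F Fz restrict_EFin.
  have iF : mu.-integrable `[z1 - h, z1] (EFin \o F^~ t1).
    apply: (@integrable_itvS _ 0 D) => //; first by lra.
    by apply: continuous_integrable_itv; exact: F_continuous_space.
  have := integrableB _ iF iFa => /(_ (measurable_itv _)).
  apply: eq_integrable => // z _ /=; rewrite -EFinB; congr (_%:E); ring.
have iF1 : mu.-integrable `[z1 - h, z1] (EFin \o F^~ t1).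
  apply: (@integrable_itvS _ 0 D) => //; first by lra.
  by apply: continuous_integrable_itv; exact: F_continuous_space.
have iF2 : mu.-integrable `[t1 - h, t1] (EFin \o F z1).
  apply: (@integrable_itvS _ 0 t1) => //; first by lra.
  by apply: continuous_integrable_itv; apply: F_continuous_time => //; apply/andP; split; lra.
have e1 : c - t1 = z1 - h by rewrite /c; ring.
have e2 : c - (t1 - h) = z1 by rewrite /c; ring.
have ia' : mu.-integrable `[c - t1, c - (t1 - h)] (EFin \o a) by rewrite e1 e2.
have : \int[mu]_(z in `[z1 - h, z1]) (F z t1 - a z) =
    \int[mu]_(t in `[t1 - h, t1]) (F z1 t - a (c - t)).
  rewrite [LHS]Rintegral_mkcond [RHS]Rintegral_mkcond /Rintegral.
  transitivity (fine (\int[mu]_z \int[mu]_t f (z, t))%E).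
    by congr fine; apply: eq_integral => z _; rewrite Fz.
  rewrite (Fubini fi); congr fine; apply: eq_integral => t _; exact: Ft.
rewrite [LHS](RintegralB _ iF1 ia)//.
rewrite [RHS](RintegralB _ iF2 (integrable_itv_reflect _ _ _ _ ia'))//.
rewrite (Rintegral_reflect c _ _ _ ia') e1 e2.
exact: addIr.
Qed.

(** Let [q x] compare [F] at the two points at distance [x] from the corner [(z + h, t + h)], one on
    each leg of the triangle. By [triangle] its primitive vanishes on [[0, h]], and [q] is
    continuous, being a difference of two primitives; so [q] is 0, and [q h = 0] is the claim. *)
Lemma potential_constant z t h : 0 <= h -> 0 <= z -> z + h <= D -> 0 <= t ->
  \int[mu]_(y in `[0, z + h]) u y 0 + \int[mu]_(s in `[0, t]) u (z + h) s =
  \int[mu]_(y in `[0, z]) u y 0 + \int[mu]_(s in `[0, t + h]) u z s.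
Proof.
rewrite le_eqVlt => /predU1P[<-|h0] z0 zhD t0.
  by rewrite (addr0 z) (addr0 t).
rewrite -!/(F _ _); pose z1 := z + h; pose t1 := t + h.
have t10 : 0 <= t1 by rewrite /t1; lra.
have z1D : 0 <= z1 <= D by apply/andP; split; rewrite /z1; lra.
pose q x := F (z1 - x) t1 - F z1 (t1 - x).
suff /(_ h) : forall x, 0 <= x <= h -> q x = 0.
  rewrite lexx ltW// => /(_ isT)/eqP; rewrite /q subr_eq0 => /eqP.
  by rewrite /z1 /t1 !addrK.
have iz : mu.-integrable `[z1 - h, z1 - 0] (EFin \o u^~ t1).
  apply: (@integrable_itvS _ 0 D); [by rewrite /z1; lra|by rewrite /z1; lra|].
  exact: profile_integrable.
have it : mu.-integrable `[t1 - h, t1 - 0] (EFin \o u z1).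
  apply: (@integrable_itvS _ 0 t1); [by rewrite /t1; lra|by rewrite /t1; lra|].
  exact: trace_integrable.
have qE x : 0 <= x <= h -> q x =
    \int[mu]_(s in `[0, x]) u z1 (t1 - s) - \int[mu]_(s in `[0, x]) u (z1 - s) t1.
  move=> /andP[x0 xh].
  rewrite (Rintegral_reflect t1 0 x); last first.
    by apply: integrable_itvS it; lra.
  rewrite (Rintegral_reflect z1 0 x (u^~ t1)); last first.
    by apply: integrable_itvS iz; lra.
  rewrite !subr0 -FB_time//; [|by rewrite /t1; lra|by lra].
  by rewrite -FB_space /q; rewrite ?/z1; [ring|lra..].
apply: eq0_of_primitive => //.
  have E : {in `[0, h], (fun x => \int[mu]_(s in `[0, x]) u z1 (t1 - s)
      - \int[mu]_(s in `[0, x]) u (z1 - s) t1) =1 q}.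
    by move=> x; rewrite inE/= in_itv/= => xh; rewrite qE.
  apply: (subspace_eq_continuous E) => x; apply: cvgB.
    apply: (parameterized_integral_continuous (ltW h0)).
    exact: integrable_itv_reflect.
  apply: (parameterized_integral_continuous (ltW h0)).
  exact: (@integrable_itv_reflect _ z1 0 h (u^~ t1)).
move=> x /andP[x0 xh].
have iFz : mu.-integrable `[z1 - x, z1 - 0] (EFin \o F^~ t1).
  apply: (@integrable_itvS _ 0 D); [by rewrite /z1; lra|by rewrite /z1; lra|].
  by apply: continuous_integrable_itv; exact: F_continuous_space.
have iFt : mu.-integrable `[t1 - x, t1 - 0] (EFin \o F z1).
  apply: (@integrable_itvS _ 0 t1); [by rewrite /t1; lra|by rewrite /t1; lra|].
  by apply: continuous_integrable_itv; exact: F_continuous_time.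
rewrite /q RintegralB//; last exact: integrable_itv_reflect.
  rewrite (Rintegral_reflect t1 0 x)// (Rintegral_reflect z1 0 x (F^~ t1))//.
  by rewrite !subr0 triangle ?subrr// /z1 /t1; lra.
exact: (@integrable_itv_reflect _ z1 0 x (F^~ t1)).
Qed.

End Characteristics.

Section Profile.
Context {R : realType}.
Local Notation mu := (@lebesgue_measure R).
Local Open Scope classical_set_scope.

(** On a bounded interval [1 + w z ^+ 2] is an integrable majorant of [|w z|]. *)
Lemma in_L2_integrable (D : R) (w : R -> R) : in_L2 D w ->
  mu.-integrable `[0, D] (EFin \o w).
Proof.
move=> [mw iw].
have i0 : mu.-integrable `[0, D] (EFin \o cst (1 : R)).
  by apply: continuousT_integrable_itv; exact: cst_continuous.
have i1 : mu.-integrable `[0, D] (EFin \o (fun z => 1 + w z ^+ 2)).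
  by apply: eq_integrable (integrableD _ i0 iw).
apply: le_integrable i1 => //; first exact/measurable_EFinP.
move=> z _ /=; rewrite lee_fin [leRHS]ger0_norm ?addr_ge0 ?sqr_ge0//.
by rewrite ler_norml; apply/andP; split; nra.
Qed.

(** The argument [s] stands for the characteristic coordinate z + t. *)
Definition delay_line (D : R) (w0 f : R -> R) (s : R) : R :=
  if s <= D then w0 s else f (s - D).

Lemma delay_lineX D w0 f (k : nat) :
  (fun s => delay_line D w0 f s ^+ k) =
  delay_line D (fun s => w0 s ^+ k) (fun s => f s ^+ k).
Proof. by apply/funext => s; rewrite /delay_line; case: ifP. Qed.

Variables (D : R) (w0 f : R -> R).
Hypothesis D_gt0 : 0 < D.
Hypothesis w0_integrable : mu.-integrable `[0, D] (EFin \o w0).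
Hypothesis f_continuous : continuous f.
Let g := delay_line D w0 f.

Let shift_continuous : continuous (fun s => f (s - D)).
Proof.
move=> s; apply: (@continuous_comp _ _ _ (fun s => s - D) f).
  by apply: cvgB; [exact: cvg_id|exact: cvg_cst].
exact: f_continuous.
Qed.

Lemma delay_line_integrable (a b : R) : 0 <= a -> mu.-integrable `[a, b] (EFin \o g).
Proof.
move=> a0; apply: (@integrable_itvS _ 0 b) => //.
apply: (@integrable_itv_cat _ 0 D b).
  apply: eq_integrable w0_integrable => // s; rewrite inE/= in_itv/= => /andP[_ sD].
  by rewrite /g /delay_line sD.
have : mu.-integrable `]D, b] (EFin \o (fun s => f (s - D))).
  apply: (integrableS _ _ _ (continuousT_integrable_itv D b _ shift_continuous)) => //.
  by apply: subset_itvr; rewrite bnd_simp.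
apply: eq_integrable => // s; rewrite inE/= in_itv/= => /andP[sD _].
by rewrite /g /delay_line leNgt sD.
Qed.

Lemma delay_line_early (x : R) : x <= D ->
  \int[mu]_(s in `[0, x]) g s = \int[mu]_(s in `[0, x]) w0 s.
Proof.
move=> xD; apply: eq_Rintegral => s; rewrite inE/= in_itv/= => /andP[_ sx].
by rewrite /g /delay_line (le_trans sx).
Qed.

Lemma delay_line_late (a b : R) : D <= a -> a <= b ->
  \int[mu]_(s in `[a, b]) g s = \int[mu]_(s in `[a - D, b - D]) f s.
Proof.
move=> Da ab; rewrite -Rintegral_shift; last exact: continuousT_integrable_itv.
(* The left endpoint is dropped because at [a = D] the function [g] takes the value [w0 D] rather
   than [f 0]. *)
rewrite -Rintegral_itv_obnd_cbnd; last first.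
  have a0 : 0 <= a := le_trans (ltW D_gt0) Da.
  apply: (integrableS _ _ _ (delay_line_integrable a b a0)) => //.
  by apply: subset_itvr; rewrite bnd_simp.
rewrite -[RHS]Rintegral_itv_obnd_cbnd; last first.
  apply: (integrableS _ _ _ (continuousT_integrable_itv a b _ shift_continuous)) => //.
  by apply: subset_itvr; rewrite bnd_simp.
apply: eq_Rintegral => s; rewrite inE/= in_itv/= => /andP[sa _].
by rewrite /g /delay_line leNgt (le_lt_trans Da).
Qed.

End Profile.

(** * Profiles and outflow as sections of a single function on characteristics *)

Section TransportTrace.
Context {R : realType}.
Local Notation mu := (@lebesgue_measure R).
Local Open Scope classical_set_scope.
Variables (D : R) (u : R -> R -> R) (f : R -> R).
Hypothesis D_gt0 : 0 < D.
Hypothesis profile_L2 : forall t : R, 0 <= t -> in_L2 D (u^~ t).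
Hypothesis trace_integrable : forall z T : R, 0 <= z <= D -> 0 <= T ->
  mu.-integrable `[0, T] (EFin \o u z).
Hypothesis joint_integrable : forall T : R, 0 <= T ->
  (mu \x mu)%E.-integrable (`[0, D] `*` `[0, T])
    (fun zt : R * R => (u zt.1 zt.2)%:E).
Hypothesis transport : forall a b t : R, 0 <= a -> a <= b -> b <= D -> 0 <= t ->
  \int[mu]_(z in `[a, b]) u z t - \int[mu]_(z in `[a, b]) u z 0 =
  \int[mu]_(s in `[0, t]) u b s - \int[mu]_(s in `[0, t]) u a s.
Hypothesis f_continuous : continuous f.
Hypothesis boundary : {ae mu, forall t : R, 0 <= t -> u D t = f t}.

Let g := delay_line D (u^~ 0) f.
Let profile_integrable t : 0 <= t -> mu.-integrable `[0, D] (EFin \o u^~ t).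
Proof. by move=> t0; apply: in_L2_integrable; exact: profile_L2. Qed.
Let g_integrable a b : 0 <= a -> mu.-integrable `[a, b] (EFin \o g).
Proof. by apply: delay_line_integrable => //; exact: profile_integrable. Qed.

(** Slide the point along its characteristic until it leaves the strip: at time 0 if [z + t <= D],
    where only the initial profile contributes, and otherwise at the boundary [z = D], where the
    trace is [f] almost everywhere. *)
Let potential z t : 0 <= z <= D -> 0 <= t ->
  \int[mu]_(y in `[0, z]) u y 0 + \int[mu]_(s in `[0, t]) u z s =
  \int[mu]_(s in `[0, z + t]) g s.
Proof.
move=> /andP[z0 zD] t0.
have pc := @potential_constant _ D u D_gt0 profile_integrable trace_integrable
  joint_integrable transport.
case: (leP (z + t) D) => ztD.
  have := pc z 0 t t0 z0 ztD (lexx _).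
  by rewrite Rintegral_itv_xx addr0 add0r => <-; rewrite delay_line_early.
have h0 : 0 <= D - z by lra.
have zhD : z + (D - z) <= D by lra.
have th : 0 <= t - (D - z) by lra.
have := pc z _ _ h0 z0 zhD th.
rewrite subrK (_ : z + (D - z) = D); last by ring.
move=> <-; rewrite (@Rintegral_itv_split _ 0 D (z + t))//;
  [|exact: ltW|exact: ltW|exact: g_integrable].
rewrite delay_line_early// delay_line_late ?subrr//; [|exact: profile_integrable|exact: ltW].
congr (_ + _); rewrite (_ : t - (D - z) = z + t - D); last by ring.
apply: ae_eq_Rintegral_itv.
- have : mu.-integrable `[0, z + t - D] (EFin \o u D).
    by apply: trace_integrable; [rewrite lexx ltW|lra].
  by move=> /integrableP[/measurable_EFinP].
- by apply: measurable_funTS; exact: continuous_measurable_fun.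
- apply: filterS boundary; first exact: (ae_filter_ringOfSetsType mu).
  by move=> s H /andP[s0 _]; exact: H.
Qed.

(** Both sides have the same primitive from 0, by [transport] and the difference of [potential] at
    [x] and at 0. The exceptional null set may depend on [t], which is harmless because only
    integrals of the profile are used afterwards. *)
Lemma profile_eq_delay_line t : 0 <= t ->
  {ae mu, forall z, 0 <= z <= D -> u z t = g (z + t)}.
Proof.
move=> t0.
have ig : mu.-integrable `[0, D] (EFin \o (fun z => g (z + t))).
  by apply: integrable_itv_shift; apply: g_integrable; rewrite add0r.
have iu := profile_integrable t t0.
have H : mu.-integrable `[0, D] (EFin \o (fun z => u z t - g (z + t))).
  rewrite (_ : _ \o _ = (EFin \o u^~ t) \- (EFin \o (fun z => g (z + t))))%E//.
  exact: integrableB.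
have := ae_eq0_of_primitive 0 D _ H.
have P x : 0 <= x <= D -> \int[mu]_(z in `[0, x]) (u z t - g (z + t)) = 0.
  move=> /andP[x0 xD].
  rewrite RintegralB//; [|by apply: integrable_itvS iu|by apply: integrable_itvS ig].
  rewrite Rintegral_shift; last by apply: g_integrable; rewrite add0r.
  rewrite add0r; have := transport 0 x t (lexx _) x0 xD t0.
  have := potential x t; rewrite x0 xD => /(_ isT t0).
  have := potential 0 t; rewrite lexx (ltW D_gt0) Rintegral_itv_xx add0r => /(_ isT t0).
  rewrite (@Rintegral_itv_split _ 0 t (x + t))//; [|by lra|exact: g_integrable].
  by rewrite add0r; lra.
move=> /(_ P); apply: filterS; first exact: (ae_filter_ringOfSetsType mu).
by move=> z + zD => /(_ zD)/eqP; rewrite subr_eq0 => /eqP.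
Qed.

Lemma outflow_eq_delay_line T : 0 <= T ->
  {ae mu, forall t, 0 <= t <= T -> u 0 t = g t}.
Proof.
move=> T0.
have D0 : 0 <= (0 : R) <= D by rewrite lexx ltW.
have H : mu.-integrable `[0, T] (EFin \o (fun t => u 0 t - g t)).
  rewrite (_ : _ \o _ = (EFin \o u 0) \- (EFin \o g))%E//; apply: integrableB => //.
    exact: trace_integrable.
  exact: g_integrable.
have := ae_eq0_of_primitive 0 T _ H.
have P x : 0 <= x <= T -> \int[mu]_(t in `[0, x]) (u 0 t - g t) = 0.
  move=> /andP[x0 xD].
  rewrite RintegralB//; [|exact: trace_integrable|exact: g_integrable].
  have := potential 0 x D0 x0; rewrite Rintegral_itv_xx !add0r => ->.
  by rewrite subrr.
move=> /(_ P); apply: filterS; first exact: (ae_filter_ringOfSetsType mu).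
by move=> z + zD => /(_ zD)/eqP; rewrite subr_eq0 => /eqP.
Qed.

Lemma delay_line_sqr_integrable a b : 0 <= a ->
  mu.-integrable `[a, b] (EFin \o (fun s => g s ^+ 2)).
Proof.
move=> a0; rewrite delay_lineX; apply: delay_line_integrable => //.
  by have [] := profile_L2 0 (lexx _).
move=> x; apply: (@continuous_comp _ _ _ f (fun y : R => y ^+ 2)).
  exact: f_continuous.
exact: exprn_continuous.
Qed.

(** The evolving profile is replaced by a sliding window on one fixed function, so that time enters
    only through the ends of the window. *)
Lemma profile_energy t : 0 <= t ->
  \int[mu]_(z in `[0, D]) u z t ^+ 2 = \int[mu]_(s in `[t, t + D]) g s ^+ 2.
Proof.
move=> t0.
rewrite -{2}[t]add0r [t + D]addrC -Rintegral_shift; last first.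
  by apply: delay_line_sqr_integrable; rewrite add0r.
apply: ae_eq_Rintegral_itv.
- by apply: measurable_funX; have [] := profile_L2 t t0.
- apply: measurable_funX.
  have : mu.-integrable `[0, D] (EFin \o (fun z => g (z + t))).
    by apply: integrable_itv_shift; apply: g_integrable; rewrite add0r.
  by move=> /integrableP[/measurable_EFinP].
- apply: filterS (profile_eq_delay_line t t0); first exact: (ae_filter_ringOfSetsType mu).
  by move=> z H zD; rewrite H.
Qed.

End TransportTrace.

(** * Differential inequalities and quadratic forms *)

Section Calculus.
Context {R : realType}.
Implicit Types (f g : R -> R) (t : R).

Lemma is_derive1D f g t a b : is_derive t (1 : R) f a -> is_derive t (1 : R) g b ->
  is_derive t (1 : R) (fun s => f s + g s) (a + b).
Proof. by move=> df dg; exact: (is_deriveD df dg). Qed.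

Lemma is_derive1M f g t a b : is_derive t (1 : R) f a -> is_derive t (1 : R) g b ->
  is_derive t (1 : R) (fun s => f s * g s) (a * g t + f t * b).
Proof.
move=> df dg; apply: (is_derive_eq (is_deriveM df dg)).
by rewrite addrC /= mulrC.
Qed.

Lemma is_derive1Z f t (k : R) a : is_derive t (1 : R) f a ->
  is_derive t (1 : R) (fun s => k * f s) (k * a).
Proof. by move=> df; exact: (is_deriveZ k df). Qed.

Lemma is_derive1_sum n (f : 'I_n -> R -> R) t (a : 'I_n -> R) :
  (forall i, is_derive t (1 : R) (f i) (a i)) ->
  is_derive t (1 : R) (fun s => \sum_i f i s) (\sum_i a i).
Proof.
move=> df; have := is_derive_sum df.
suff -> : \sum_(i < n) f i = (fun s => \sum_i f i s) by [].
by rewrite fct_sumE.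
Qed.

Lemma continuous_sumr (T : topologicalType) n (f : 'I_n -> T -> R) :
  (forall i, continuous (f i)) -> continuous (fun s => \sum_i f i s).
Proof.
move=> cf.
have H (r : seq 'I_n) : continuous (fun s => \sum_(i <- r) f i s).
  elim: r => [|i r IH] s.
    have -> : (fun s => \sum_(i <- [::]) f i s) = cst 0.
      by apply/funext => y; rewrite big_nil.
    exact: cst_continuous.
  have -> : (fun s => \sum_(j <- i :: r) f j s) = (fun s => f i s + \sum_(j <- r) f j s).
    by apply/funext => y; rewrite big_cons.
  by apply: cvgD; [exact: cf|exact: IH].
exact: H.
Qed.

(** The product of [V] with [expR (- k * s)] is nonincreasing. The sign of [k] is free: the lemma
    serves as Gronwall's growth bound on [[0, D]] and as the decay estimate after [D]. *)
Lemma exponential_comparison (V dV : R -> R) (a b k : R) :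
  {within `[a, b], continuous V}%classic ->
  (forall t, a < t < b -> is_derive t (1 : R) V (dV t)) ->
  (forall t, a < t < b -> dV t <= k * V t) ->
  forall t, a <= t <= b -> V t <= expR (k * (t - a)) * V a.
Proof.
move=> cV dVE dVle t /andP[at_ tb].
pose e (s : R) := expR (- k * s).
have ce : continuous e.
  move=> s; apply: (@continuous_comp _ _ _ (fun s => - k * s) expR).
    exact: mulrl_continuous.
  exact: continuous_expR.
have de (s : R) : is_derive s (1 : R) e (e s * - k).
  have := @is_derive1_comp R expR (fun s => - k * s) s (e s) (- k * 1)
    (is_derive_expR _) (is_derive1Z id s (- k) 1 (is_derive_id _ _)).
  by rewrite mulr1.
pose W s := e s * V s.
have dW s : a < s < b -> is_derive s (1 : R) W (e s * - k * V s + e s * dV s).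
  by move=> sab; apply: is_derive1M => //; exact: dVE.
have cW : {within `[a, b], continuous W}%classic.
  move=> s; apply: cvgM; last exact: cV.
  exact: (continuous_subspaceT ce).
have WW : W t <= W a.
  apply: (@ler0_derive1_le_cc R W a t) => //.
  - move=> s; rewrite in_itv/= => /andP[s1 s2].
    have sab : a < s < b by rewrite s1 (lt_le_trans s2).
    exact: (@ex_derive _ _ _ _ _ _ _ (dW _ sab)).
  - move=> s; rewrite in_itv/= => /andP[s1 s2].
    have sab : a < s < b by rewrite s1 (lt_le_trans s2).
    have D := dW _ sab; rewrite derive1E derive_val -mulrA -mulrDr.
    by rewrite pmulr_rle0 ?expR_gt0//; have := dVle _ sab; lra.
  - apply: continuous_subspaceW cW => s /=; rewrite !in_itv/= => /andP[-> st].
    exact: le_trans st tb.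
  - by rewrite in_itv/= lexx at_.
  - by rewrite in_itv/= lexx at_.
move: WW; rewrite /W -ler_pdivlMl ?expR_gt0// mulrA => /le_trans; apply.
rewrite -expRN -expRD (_ : _ + _ = k * (t - a))//.
by rewrite mulNr opprK; ring.
Qed.

End Calculus.

(** * Quadratic forms compared with the Euclidean norm *)

Section QuadraticForms.
Context {R : realType}.

Definition qform {m} (S : 'M[R]_m) (x : 'cV[R]_m) : R := (x^T *m S *m x) 0 0.

Definition sqnorm {m} (x : 'cV[R]_m) : R := \sum_i x i 0 ^+ 2.

Lemma qformE {m} (S : 'M[R]_m) x : qform S x = \sum_i \sum_j x i 0 * (S i j * x j 0).
Proof.
rewrite /qform -mulmxA mxE; apply: eq_bigr => i _.
by rewrite !mxE mulr_sumr; apply: eq_bigr.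
Qed.

Lemma qform0 {m} (S : 'M[R]_m) : qform S 0 = 0.
Proof. by rewrite /qform mulmx0 mxE. Qed.

Lemma sqnorm0 {m} : sqnorm (0 : 'cV[R]_m) = 0.
Proof. by rewrite /sqnorm big1// => i _; rewrite mxE expr0n. Qed.

Lemma sqnorm_ge0 {m} (x : 'cV[R]_m) : 0 <= sqnorm x.
Proof. by apply: sumr_ge0 => i _; exact: sqr_ge0. Qed.

Lemma sqnorm_coord {m} (x : 'cV[R]_m) i : x i 0 ^+ 2 <= sqnorm x.
Proof. by rewrite /sqnorm (bigD1 i)//= lerDl sumr_ge0// => j _; exact: sqr_ge0. Qed.

Lemma sqnorm_eq0 {m} (x : 'cV[R]_m) : sqnorm x = 0 -> x = 0.
Proof.
move=> x0; apply/colP => i; rewrite mxE; apply/eqP.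
by rewrite -sqrf_eq0 eq_le sqr_ge0 -x0 sqnorm_coord.
Qed.

Lemma sqnormZ {m} (k : R) (x : 'cV[R]_m) : sqnorm (k *: x) = k ^+ 2 * sqnorm x.
Proof. by rewrite /sqnorm mulr_sumr; apply: eq_bigr => i _; rewrite mxE exprMn. Qed.

Lemma sqnormD {m} (x y : 'cV[R]_m) : sqnorm (x + y) <= 2 * sqnorm x + 2 * sqnorm y.
Proof.
rewrite /sqnorm !mulr_sumr -big_split; apply: ler_sum => i _; rewrite mxE/=.
have := sqr_ge0 (x i 0 - y i 0); nra.
Qed.

Lemma sqnorm_col_mx {m p} (x : 'cV[R]_m) (y : 'cV[R]_p) :
  sqnorm (col_mx x y) = sqnorm x + sqnorm y.
Proof.
rewrite /sqnorm big_split_ord/=; congr (_ + _); apply: eq_bigr => i _.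
  by rewrite col_mxEu.
by rewrite col_mxEd.
Qed.

Lemma qformZ {m} (S : 'M[R]_m) (k : R) x : qform S (k *: x) = k ^+ 2 * qform S x.
Proof.
rewrite !qformE mulr_sumr; apply: eq_bigr => i _.
by rewrite mulr_sumr; apply: eq_bigr => j _; rewrite !mxE; ring.
Qed.

Lemma mul_le_sqnorm {m} (x : 'cV[R]_m) i j : `|x i 0 * x j 0| <= sqnorm x.
Proof.
have := sqnorm_coord x i; have := sqnorm_coord x j.
by rewrite ler_norml => ? ?; apply/andP; split; have := sqr_ge0 (x i 0 - x j 0);
  have := sqr_ge0 (x i 0 + x j 0); nra.
Qed.

Lemma qform_le {m} (S : 'M[R]_m) :
  exists2 C : R, 0 < C & forall x, `|qform S x| <= C * sqnorm x.
Proof.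
exists (1 + \sum_i \sum_j `|S i j|).
  by rewrite ltr_pwDl// sumr_ge0// => i _; rewrite sumr_ge0.
move=> x; rewrite qformE.
apply: (@le_trans _ _ ((\sum_i \sum_j `|S i j|) * sqnorm x)); last first.
  by rewrite ler_wpM2r ?sqnorm_ge0// lerDr.
rewrite mulr_suml (le_trans (ler_norm_sum _ _ _))//; apply: ler_sum => i _.
rewrite mulr_suml (le_trans (ler_norm_sum _ _ _))//; apply: ler_sum => j _.
by rewrite mulrCA normrM ler_wpM2l// mul_le_sqnorm.
Qed.

Lemma sqnorm_mulmx_le {m p} (S : 'M[R]_(m, p)) :
  exists2 C : R, 0 < C & forall x, sqnorm (S *m x) <= C * sqnorm x.
Proof.
have [C C0 CE] := qform_le (S^T *m S); exists C => // x.
apply: le_trans (le_trans (ler_norm _) (CE x)).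
rewrite /qform mulmxA -mulmxA -trmx_mul [leRHS]mxE /sqnorm.
by apply: ler_sum => i _; rewrite [(_^T) _ _]mxE expr2.
Qed.

Lemma is_derive_qform {m} (S : 'M[R]_m) (x : R -> 'cV[R]_m) (y : 'cV[R]_m) (t : R) :
  (forall i, is_derive t (1 : R) (fun s => x s i 0) (y i 0)) ->
  is_derive t (1 : R) (fun s => qform S (x s))
    ((y^T *m S *m x t + (x t)^T *m S *m y) 0 0).
Proof.
move=> dx; rewrite (_ : (fun s => _) =
    (fun s => \sum_i \sum_j x s i 0 * (S i j * x s j 0))); last first.
  by apply/funext => s; rewrite qformE.
have H : is_derive t (1 : R) (fun s => \sum_i \sum_j x s i 0 * (S i j * x s j 0))
    (\sum_i \sum_j (y i 0 * (S i j * x t j 0) + x t i 0 * (S i j * y j 0))).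
  apply: is_derive1_sum => i; apply: is_derive1_sum => j.
  by apply: is_derive1M => //; exact: is_derive1Z.
apply: (is_derive_eq H).
rewrite mxE -!mulmxA !mxE -big_split; apply: eq_bigr => i _.
rewrite [(_^T) _ _]mxE [(_^T) _ _]mxE !mxE !mulr_sumr -big_split.
by apply: eq_bigr => j _.
Qed.

Lemma continuous_qform {m} (T : topologicalType) (S : 'M[R]_m) (x : T -> 'cV[R]_m) :
  (forall i, continuous (fun s => x s i 0)) -> continuous (fun s => qform S (x s)).
Proof.
move=> cx; rewrite (_ : (fun s => _) =
    (fun s => \sum_i \sum_j x s i 0 * (S i j * x s j 0))); last first.
  by apply/funext => s; rewrite qformE.
apply: continuous_sumr => i; apply: continuous_sumr => j s.
by apply: cvgM; [exact: cx|apply: cvgM; [exact: cvg_cst|exact: cx]].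
Qed.

Lemma sqnormE {m} (x : 'cV[R]_m) : sqnorm x = qform 1%:M x.
Proof. by rewrite /qform mulmx1 mxE; apply: eq_bigr => i _; rewrite mxE expr2. Qed.

Lemma continuous_sqnorm {m} (T : topologicalType) (x : T -> 'cV[R]_m) :
  (forall i, continuous (fun s => x s i 0)) -> continuous (fun s => sqnorm (x s)).
Proof.
move=> cx; have -> : (fun s => sqnorm (x s)) = (fun s => qform 1%:M (x s)).
  by apply/funext => s; rewrite sqnormE.
exact: continuous_qform.
Qed.

Lemma is_derive_sqnorm {m} (x : R -> 'cV[R]_m) (y : 'cV[R]_m) (t : R) :
  (forall i, is_derive t (1 : R) (fun s => x s i 0) (y i 0)) ->
  is_derive t (1 : R) (fun s => sqnorm (x s)) (\sum_i 2 * (x t i 0 * y i 0)).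
Proof.
move=> dx; apply: is_derive1_sum => i.
have := is_derive1M _ _ _ _ _ (dx i) (dx i).
have -> : (fun s => x s i 0 ^+ 2) = (fun s => x s i 0 * x s i 0).
  by apply/funext => s; rewrite expr2.
by move=> H; apply: (is_derive_eq H); ring.
Qed.

Lemma dot_le_sqnorm {m} (x y : 'cV[R]_m) :
  \sum_i 2 * (x i 0 * y i 0) <= sqnorm x + sqnorm y.
Proof.
rewrite /sqnorm -big_split; apply: ler_sum => i _ /=.
have := sqr_ge0 (x i 0 - y i 0); nra.
Qed.

Lemma sphere_compact m :
  compact [set v : 'rV[R]_m | sqnorm v^T = 1]%classic.
Proof.
apply: bounded_closed_compact.
  exists 1; split => // M M1 v /= v1; rewrite [leLHS]mx_normrE.
  apply: bigmax_le => [|[i j] _]; first by rewrite (le_trans _ (ltW M1)).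
  rewrite (le_trans _ (ltW M1))//= (ord1 i).
  by have := sqnorm_coord v^T j; rewrite v1 mxE -real_normK ?num_real// expr_le1.
apply: (@preimage_closed _ _ (fun v : 'rV[R]_m => sqnorm v^T) [set y | y = 1]%classic).
  move=> v _; rewrite /sqnorm; apply: continuous_sumr => i {}v.
  rewrite (_ : (fun _ => _) = (fun v : 'rV[R]_m => v 0 i * v 0 i)); last first.
    by apply/funext => w; rewrite mxE expr2.
  have c := @coord_continuous R 1 m 0 i v; exact: (cvgM c c).
exact: closed_eq.
Qed.

(** The form attains its minimum on the compact unit sphere, at a nonzero vector, so the minimum is
    positive; homogeneity of degree 2 carries the bound to all vectors. *)
Lemma posdef_ge {m} (S : 'M[R]_m) : posdef S ->
  exists2 c : R, 0 < c & forall x, c * sqnorm x <= qform S x.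
Proof.
move=> S0; pose sphere := [set v : 'rV[R]_m | sqnorm v^T = 1]%classic.
(* An empty sphere means dimension 0: normalising a nonzero vector would give a point of it. Any
   constant then works. *)
have [[v0 v01]|sphere0] := pselect (sphere !=set0)%classic; last first.
  exists 1 => // x; suff -> : x = 0.
    by rewrite qform0 sqnorm0 mulr0.
  apply/eqP/negP => /negP x0; apply: sphere0.
  have nx : 0 < sqnorm x.
    by rewrite lt_neqAle sqnorm_ge0 andbT eq_sym; apply: contra x0 => /eqP/sqnorm_eq0 ->.
  exists ((Num.sqrt (sqnorm x))^-1 *: x)^T.
  by rewrite /sphere/= trmxK sqnormZ exprVn sqr_sqrtr ?ltW// mulVf// gt_eqF.
have cf : continuous (fun v : 'rV[R]_m => qform S v^T).
  rewrite (_ : (fun v => _) =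
      (fun v : 'rV[R]_m => \sum_i \sum_j v 0 i * (S i j * v 0 j))); last first.
    apply/funext => v; rewrite qformE; apply: eq_bigr => i _.
    by apply: eq_bigr => j _; rewrite !mxE.
  apply: continuous_sumr => i; apply: continuous_sumr => j v.
  have ci := @coord_continuous R 1 m 0 i v; have cj := @coord_continuous R 1 m 0 j v.
  exact: (cvgM ci (cvgM (cvg_cst _) cj)).
have [||c cS cmin] := @compact_EVT_min _ R
  (fun v : 'rV[R]_m => qform S v^T) sphere _ (@sphere_compact m).
- by exists v0.
- by apply: continuous_subspaceT => v; exact: cf.
exists (qform S c^T).
  apply: S0; apply/eqP => c0; move: cS; rewrite inE/= /sphere/= c0 /sqnorm big1.
    by move/eqP; rewrite eq_sym oner_eq0.
  by move=> i _; rewrite mxE expr0n.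
move=> x; have [->|x0] := eqVneq x 0.
  by rewrite qform0 sqnorm0 mulr0.
have nx : 0 < sqnorm x.
  by rewrite lt_neqAle sqnorm_ge0 andbT eq_sym; apply: contra x0 => /eqP/sqnorm_eq0 ->.
pose k := (Num.sqrt (sqnorm x))^-1.
have k2 : k ^+ 2 = (sqnorm x)^-1 by rewrite exprVn sqr_sqrtr// ltW.
have := cmin (k *: x)^T; rewrite trmxK qformZ k2 => H.
rewrite -ler_pdivlMr// mulrC; apply: H.
by rewrite inE/= /sphere/= trmxK sqnormZ k2 mulVf// gt_eqF.
Qed.

End QuadraticForms.

(** * Legendre polynomials on [0, D] *)

Section PolynomialIntegrals.
Context {R : realType}.
Local Notation mu := (@lebesgue_measure R).
Local Open Scope classical_set_scope.
Implicit Types (f g : R -> R) (p q : {poly R}).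

Lemma Rintegral_itvD (a b : R) f g : continuous f -> continuous g ->
  \int[mu]_(x in `[a, b]) (f x + g x) =
  \int[mu]_(x in `[a, b]) f x + \int[mu]_(x in `[a, b]) g x.
Proof. by move=> cf cg; apply: RintegralD => //; exact: continuousT_integrable_itv. Qed.

Lemma Rintegral_itvZ (a b k : R) f : continuous f ->
  \int[mu]_(x in `[a, b]) (k * f x) = k * \int[mu]_(x in `[a, b]) f x.
Proof. by move=> cf; apply: RintegralZl => //; exact: continuousT_integrable_itv. Qed.

Lemma Rintegral_itv_sum (a b : R) n (f : 'I_n -> R -> R) :
  (forall i, continuous (f i)) ->
  \int[mu]_(x in `[a, b]) (\sum_i f i x) = \sum_i \int[mu]_(x in `[a, b]) f i x.
Proof.
move=> cf.
have H (r : seq 'I_n) : continuous (fun x => \sum_(i <- r) f i x) /\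
  \int[mu]_(x in `[a, b]) (\sum_(i <- r) f i x) =
  \sum_(i <- r) \int[mu]_(x in `[a, b]) f i x.
  elim: r => [|i r [c IH]].
    have -> : (fun s => \sum_(i <- [::]) f i s) = cst 0.
      by apply/funext => y; rewrite big_nil.
    split; first exact: cst_continuous.
    by rewrite big_nil Rintegral_cst// mul0r.
  have -> : (fun s => \sum_(j <- i :: r) f j s) = (fun s => f i s + \sum_(j <- r) f j s).
    by apply/funext => y; rewrite big_cons.
  split; first by move=> x; apply: cvgD; [exact: cf|exact: c].
  by rewrite big_cons -IH -Rintegral_itvD.
exact: (H _).2.
Qed.

Lemma continuousMr (T : topologicalType) (f g : T -> R) :
  continuous f -> continuous g -> continuous (fun x => f x * g x).
Proof. by move=> cf cg x; apply: cvgM; [exact: cf|exact: cg]. Qed.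

Lemma horner_LRcontinuous (a b : R) p :
  derivable_oo_LRcontinuous (fun x => p.[x]) a b.
Proof.
split; first by move=> x _; exact: derivable_horner.
- by apply: cvg_at_right_filter; exact: continuous_horner.
- by apply: cvg_at_left_filter; exact: continuous_horner.
Qed.

Lemma Rintegral_horner_by_parts (a b : R) p q : a < b ->
  \int[mu]_(x in `[a, b]) (p.[x] * q^`().[x]) =
  p.[b] * q.[b] - p.[a] * q.[a] - \int[mu]_(x in `[a, b]) (p^`().[x] * q.[x]).
Proof.
move=> ab; apply: (@Rintegration_by_parts R (horner p) (horner q)) => //.
- by apply: continuous_subspaceT => x; exact: continuous_horner.
- exact: horner_LRcontinuous.
- by move=> x _; rewrite derivE.
- by apply: continuous_subspaceT => x; exact: continuous_horner.
- exact: horner_LRcontinuous.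
- by move=> x _; rewrite derivE.
Qed.

End PolynomialIntegrals.

Section Legendre.
Context {R : realType}.
Local Notation mu := (@lebesgue_measure R).
Variable D : R.
Hypothesis D_gt0 : 0 < D.

Let c : {poly R} := (2 / D)%:P.

(* Affine map of [0, D] onto [-1, 1]. *)
Let Y : {poly R} := c * 'X - 1.

(* The Legendre polynomials transported to [0, D], by Bonnet's recursion. *)
Fixpoint legendre_pair (k : nat) : {poly R} * {poly R} :=
  if k is k'.+1 then
    let: (p, q) := legendre_pair k' in
    (q, (k'.+2%:R^-1)%:P * ((2 * k' + 3)%:R * Y * q - k'.+1%:R * p))
  else (1, Y).

Definition legendre (k : nat) : {poly R} := (legendre_pair k).1.

Let legendre0 : legendre 0 = 1. Proof. by []. Qed.
Let legendre1 : legendre 1 = Y. Proof. by []. Qed.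

Lemma bonnet k : k.+2%:R * legendre k.+2 =
  (2 * k + 3)%:R * Y * legendre k.+1 - k.+1%:R * legendre k.
Proof.
rewrite /legendre /=; case: (legendre_pair k) => p q /=.
by rewrite mulrA -polyC_natr -polyCM divff ?pnatr_eq0// mul1r.
Qed.

Let deriv_nat (n : nat) : (n%:R : {poly R})^`() = 0.
Proof. by rewrite -polyC_natr derivC. Qed.

Let deriv_Y : Y^`() = c.
Proof. by rewrite /Y derivB derivM derivX !derivC mul0r add0r mulr1 subr0. Qed.

Let natp_inj (n : nat) : injective (fun p : {poly R} => n.+1%:R * p).
Proof. by apply: mulfI; rewrite -polyC_natr polyC_eq0 pnatr_eq0. Qed.

Let deriv_bonnet k : k.+2%:R * (legendre k.+2)^`() =
  (2 * k + 3)%:R * (c * legendre k.+1 + Y * (legendre k.+1)^`())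
  - k.+1%:R * (legendre k)^`().
Proof.
have := congr1 (@deriv R) (bonnet k).
rewrite derivB !derivM !deriv_nat deriv_Y !mul0r !add0r => ->.
ring.
Qed.

(** In the variable y on [-1, 1] these are y P'_(k+1) = (k+1) P_(k+1) + P'_k and (y^2 - 1) P'_(k+1)
    = (k+1) (y P_(k+1) - P_k); the factor [c] comes from the chain rule. They are proved together
    because the second at [k] is what yields the first at [k.+1]. *)
Let legendre_ladder k :
  Y * (legendre k.+1)^`() = k.+1%:R * c * legendre k.+1 + (legendre k)^`() /\
  (Y ^+ 2 - 1) * (legendre k.+1)^`() =
    k.+1%:R * c * (Y * legendre k.+1 - legendre k).
Proof.
elim: k => [|k [hA hC]].
  by rewrite legendre0 legendre1 deriv_Y derivC; split; ring.
have hB : (legendre k.+2)^`() =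
    k.+2%:R * c * legendre k.+1 + Y * (legendre k.+1)^`().
  apply: (@natp_inj k.+1); rewrite deriv_bonnet.
  have -> : (legendre k)^`() =
     Y * (legendre k.+1)^`() - k.+1%:R * c * legendre k.+1 by rewrite hA; ring.
  ring.
have hA' : Y * (legendre k.+2)^`() =
    k.+2%:R * c * legendre k.+2 + (legendre k.+1)^`().
  rewrite hB.
  have -> : k.+2%:R * c * legendre k.+2 = c * (k.+2%:R * legendre k.+2) by ring.
  rewrite bonnet.
  apply/eqP; rewrite -subr_eq0; apply/eqP.
  transitivity ((Y ^+ 2 - 1) * (legendre k.+1)^`() -
    k.+1%:R * c * (Y * legendre k.+1 - legendre k)); first ring.
  by rewrite hC subrr.
split=> //.
have -> : (Y ^+ 2 - 1) * (legendre k.+2)^`() =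
  Y * (Y * (legendre k.+2)^`()) - (legendre k.+2)^`() by ring.
rewrite hA' hB; ring.
Qed.

Let legendre_step k : (legendre k.+2)^`() =
  (legendre k)^`() + (2 * k + 3)%:R * c * legendre k.+1.
Proof.
have [hA _] := legendre_ladder k.
apply: (@natp_inj k.+1); rewrite deriv_bonnet hA; ring.
Qed.

(** The factor [1 - (-1) ^+ (k + i)] is 2 if [k] and [i] have different parities and 0 otherwise, so
    the sum is [legendre_step] telescoped in steps of two. For that reason the induction carries two
    consecutive indices. *)
Let deriv_legendre_nat k : (legendre k)^`() =
  \sum_(i < k) (D^-1 * ((2 * i + 1)%:R * (1 - (-1) ^+ (k + i)))) *: legendre i.
Proof.
suff: (legendre k)^`() =
   \sum_(i < k) (D^-1 * ((2 * i + 1)%:R * (1 - (-1) ^+ (k + i)))) *: legendre i /\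
   (legendre k.+1)^`() =
   \sum_(i < k.+1) (D^-1 * ((2 * i + 1)%:R * (1 - (-1) ^+ (k.+1 + i)))) *: legendre i.
  by case.
elim: k => [|k [IH IH1]]; split => //.
- by rewrite legendre0 derivC big_ord0.
- rewrite legendre1 deriv_Y big_ord1 legendre0 /= -mul_polyC mulr1; congr (_%:P).
  by rewrite expr1; ring.
rewrite legendre_step IH !big_ord_recr/= -!mul_polyC.
rewrite [X in _ = X + _ + _](_ : _ =
    \sum_(i < k) (D^-1 * ((2 * i + 1)%:R * (1 - (-1) ^+ (k + i)))) *: legendre i); last first.
  by apply: eq_bigr => i _; rewrite !addSn !exprS !mulN1r opprK.
rewrite -addrA; congr (_ + _).
have -> : (-1) ^+ (k.+2 + k) = 1 :> R.
  by rewrite -signr_odd oddD /= negbK addbb expr0.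
have -> : (-1) ^+ (k.+2 + k.+1) = -1 :> R.
  by rewrite -signr_odd oddD /= negbK addbN addbb expr1.
rewrite subrr !mulr0 mul0r add0r /c -polyC_natr -polyCM; congr (_%:P * _).
by rewrite (_ : (2 * k.+1 + 1 = 2 * k + 3)%N); [ring|lia].
Qed.

(** The derivative stays in the span of the first [l] polynomials, so the differential equation of
    the first [l] moments is closed up to boundary values. *)
Lemma deriv_legendre l (k : 'I_l) : (legendre k)^`() =
  \sum_(i < l) (D^-1 * legM l k i) *: legendre i.
Proof.
rewrite deriv_legendre_nat (big_ord_widen l (fun i : nat =>
  (D^-1 * ((2 * i + 1)%:R * (1 - (-1) ^+ (k + i)))) *: legendre i)) ?(ltnW (ltn_ord k))//.
rewrite big_mkcond.
by apply: eq_bigr => i _; rewrite mxE; case: ifP => //; rewrite mulr0 scale0r.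
Qed.

Let Y_right : Y.[D] = 1.
Proof.
by rewrite /Y /c !hornerE -mulrA mulVf ?gt_eqF// mulr1; ring.
Qed.

Let Y_left : Y.[0] = -1.
Proof. by rewrite /Y /c !hornerE; ring. Qed.

Let horner_nat (n : nat) x : (n%:R : {poly R}).[x] = n%:R.
Proof. by rewrite -polyC_natr hornerC. Qed.

Lemma legendre_right k : (legendre k).[D] = 1.
Proof.
suff: (legendre k).[D] = 1 /\ (legendre k.+1).[D] = 1 by case.
elim: k => [|k [IH IH1]]; first by rewrite legendre0 legendre1 hornerC Y_right.
split => //; have := congr1 (fun p => p.[D]) (bonnet k).
(* [Y] is made opaque so that evaluation stops at [Y.[D]], whose value is known, instead of
   expanding the affine map. *)
move: Y_right; generalize Y => y yD.
rewrite !hornerE !horner_nat yD IH IH1 => H.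
apply: (mulfI (_ : k.+2%:R != 0 :> R)); first by rewrite pnatr_eq0.
rewrite H; ring.
Qed.

Lemma legendre_left k : (legendre k).[0] = (-1) ^+ k.
Proof.
suff: (legendre k).[0] = (-1) ^+ k /\ (legendre k.+1).[0] = (-1) ^+ k.+1 by case.
elim: k => [|k [IH IH1]].
  by rewrite legendre0 legendre1 hornerC Y_left expr0 expr1.
split => //; have := congr1 (fun p => p.[0]) (bonnet k).
move: Y_left; generalize Y => y y0.
rewrite !hornerE !horner_nat y0 IH IH1 => H.
apply: (mulfI (_ : k.+2%:R != 0 :> R)); first by rewrite pnatr_eq0.
rewrite H !exprS; ring.
Qed.

Let ip (p q : {poly R}) := \int[mu]_(z in `[0, D]) (p.[z] * q.[z]).

Let ipC p q : ip p q = ip q p.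
Proof. by apply: eq_Rintegral => z _; rewrite mulrC. Qed.

Let chp (p : {poly R}) : continuous (fun z => p.[z]).
Proof. exact: continuous_horner. Qed.

Let ipZ a p q : ip (a *: p) q = a * ip p q.
Proof.
rewrite /ip -Rintegral_itvZ; last exact: continuousMr.
by apply: eq_Rintegral => z _; rewrite hornerZ mulrA.
Qed.

Let ipZr a p q : ip p (a *: q) = a * ip p q.
Proof. by rewrite ipC ipZ ipC. Qed.

Let ip_suml n (p : 'I_n -> {poly R}) q : ip (\sum_i p i) q = \sum_i ip (p i) q.
Proof.
rewrite /ip -Rintegral_itv_sum; last by move=> i; exact: continuousMr.
by apply: eq_Rintegral => z _; rewrite horner_sum mulr_suml.
Qed.

Let ip_parts p q : ip p q^`() = p.[D] * q.[D] - p.[0] * q.[0] - ip p^`() q.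
Proof. exact: Rintegral_horner_by_parts. Qed.

(** Legendre's differential equation with eigenvalue k(k+1), rescaled by the square of [2 / D] for
    its two derivatives. *)
Let sturm_liouville k : ((Y ^+ 2 - 1) * (legendre k)^`())^`() =
  ((k * k.+1)%:R * (2 / D) ^+ 2) *: legendre k.
Proof.
case: k => [|k]; first by rewrite legendre0 derivC mulr0 deriv0 mul0n mul0r scale0r.
have [hA hC] := legendre_ladder k.
rewrite hC derivM derivM deriv_nat derivC derivB derivM deriv_Y !(mul0r, mulr0, add0r, addr0).
rewrite -mul_polyC polyCM polyC_exp -/c polyC_natr natrM.
rewrite hA; ring.
Qed.

Let W_right : (Y ^+ 2 - 1).[D] = 0.
Proof. by move: Y_right; generalize Y => y yD; rewrite !hornerE yD; ring. Qed.

Let W_left : (Y ^+ 2 - 1).[0] = 0.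
Proof. by move: Y_left; generalize Y => y y0; rewrite !hornerE y0; ring. Qed.

(** The weight [Y ^+ 2 - 1] vanishes at both ends, so integration by parts makes the Sturm-Liouville
    operator symmetric; eigenvectors for the distinct eigenvalues i(i+1) and j(j+1) are then
    orthogonal. *)
Lemma legendre_orthogonal i j : i != j ->
  \int[mu]_(z in `[0, D]) ((legendre i).[z] * (legendre j).[z]) = 0.
Proof.
move=> ij; rewrite -/(ip _ _).
have H k m : ((k * k.+1)%:R * (2 / D) ^+ 2) * ip (legendre m) (legendre k) =
    - \int[mu]_(z in `[0, D])
       ((Y ^+ 2 - 1).[z] * ((legendre m)^`().[z] * (legendre k)^`().[z])).
  rewrite -ipZr -sturm_liouville ip_parts.
  move: W_right W_left; generalize (Y ^+ 2 - 1) => W WD W0.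
  rewrite !hornerM WD W0 !mul0r !mulr0 subrr sub0r; congr (- _).
  by apply: eq_Rintegral => z _; rewrite hornerM mulrCA.
have e : \int[mu]_(z in `[0, D])
     ((Y ^+ 2 - 1).[z] * ((legendre i)^`().[z] * (legendre j)^`().[z])) =
   \int[mu]_(z in `[0, D])
     ((Y ^+ 2 - 1).[z] * ((legendre j)^`().[z] * (legendre i)^`().[z])).
  by apply: eq_Rintegral => z _; rewrite [X in _ * X]mulrC.
have := H i j; rewrite -e -H ipC => /eqP; rewrite -subr_eq0 -mulrBl mulf_eq0.
case/orP => [|/eqP //]; rewrite -mulrBl mulf_eq0 => /orP[|]; last first.
  by rewrite sqrf_eq0 mulf_eq0 invr_eq0 pnatr_eq0 (gt_eqF D_gt0).
rewrite subr_eq0 eqr_nat => /eqP h; case/negP: ij; apply/eqP; nia.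
Qed.

(** The product of [legendre k] with the derivative of [legendre k.+1] is integrated in two ways. By
    parts it is 2, the boundary contribution, since the derivative of [legendre k] is orthogonal to
    [legendre k.+1]; by [legendre_step] it is [(2 * k + 1)%:R * (2 / D)] times the squared norm. *)
Lemma legendre_sqnorm k :
  \int[mu]_(z in `[0, D]) ((legendre k).[z] * (legendre k).[z]) = D / (2 * k + 1)%:R.
Proof.
rewrite -/(ip _ _).
have lower m n : (m <= n)%N -> ip (legendre m)^`() (legendre n) = 0.
  move=> mn; rewrite deriv_legendre_nat ip_suml big1// => i _.
  by rewrite ipZ [ip _ _]legendre_orthogonal ?mulr0// neq_ltn (leq_trans _ mn).
have two : ip (legendre k) (legendre k.+1)^`() = 2.
  rewrite ip_parts lower// !legendre_right !legendre_left mulr1 subr0.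
  by rewrite exprS mulrCA -expr2 sqrr_sign; ring.
have step : ip (legendre k) (legendre k.+1)^`() =
    (2 * k + 1)%:R * (2 / D) * ip (legendre k) (legendre k).
  case: k {two} => [|k].
    by rewrite legendre1 deriv_Y legendre0 /c -[_%:P]mulr1 mul_polyC ipZr; ring.
  rewrite legendre_step /ip.
  under eq_Rintegral do rewrite hornerD mulrDr.
  rewrite Rintegral_itvD; [|exact: continuousMr|exact: continuousMr].
  have := lower k k.+1 (leqnSn _); rewrite /ip.
  under eq_Rintegral do rewrite mulrC.
  move=> ->; rewrite add0r -/(ip _ _) /c -polyC_natr -polyCM mul_polyC -/(ip _ _) ipZr.
  by rewrite (_ : (2 * k.+1 + 1 = 2 * k + 3)%N); [|lia].
have D0 : D != 0 by rewrite gt_eqF.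
have k0 : (2 * k + 1)%:R != 0 :> R by rewrite pnatr_eq0; lia.
apply: (mulfI (_ : (2 * k + 1)%:R * (2 / D) != 0)).
  by rewrite !mulf_neq0// ?invr_eq0// pnatr_eq0.
rewrite -step two; field; rewrite D0 andbT.
by move: k0; rewrite natrD natrM.
Qed.

Lemma bessel_legendre l (w : R -> R) : continuous w ->
  \sum_(k < l) (2 * k + 1)%:R / D *
     (\int[mu]_(z in `[0, D]) ((legendre k).[z] * w z)) ^+ 2 <=
  \int[mu]_(z in `[0, D]) (w z ^+ 2).
Proof.
move=> cw.
pose m k := \int[mu]_(z in `[0, D]) ((legendre k).[z] * w z).
(* The Fourier coefficient: the moment divided by the squared norm of [legendre k]. Thus [q] is the
   orthogonal projection of [w], and the claim is that [w - q] has nonnegative squared norm. *)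
pose a (k : nat) := (2 * k + 1)%:R / D * m k.
pose q := \sum_(k < l) a k *: legendre k.
have qw : \int[mu]_(z in `[0, D]) (q.[z] * w z) = \sum_(k < l) a k * m k.
  under eq_Rintegral do rewrite horner_sum mulr_suml.
  rewrite Rintegral_itv_sum; last by move=> i; exact: continuousMr.
  apply: eq_bigr => i _; rewrite /m -Rintegral_itvZ; last exact: continuousMr.
  by apply: eq_Rintegral => z _; rewrite hornerZ mulrA.
have qq : ip q q = \sum_(k < l) a k * m k.
  rewrite ip_suml; apply: eq_bigr => i _; rewrite ipZ ipC ip_suml (bigD1 i)//= big1.
    rewrite ipZ [ip _ _]legendre_sqnorm addr0 /a; congr (_ * _).
    have i0 : (2 * i + 1)%:R != 0 :> R by rewrite pnatr_eq0; lia.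
    field; rewrite (gt_eqF D_gt0)/=.
    by move: i0; rewrite natrD natrM => ->.
  by move=> j ji; rewrite ipZ [ip _ _]legendre_orthogonal ?mulr0.
have -> : \sum_(k < l) (2 * k + 1)%:R / D * m k ^+ 2 = \sum_(k < l) a k * m k.
  by apply: eq_bigr => k _; rewrite /a expr2 mulrA.
have : 0 <= \int[mu]_(z in `[0, D]) ((w z - q.[z]) ^+ 2).
  by apply: Rintegral_ge0 => z _; exact: sqr_ge0.
have cq : continuous (fun z => q.[z] * w z) by exact: continuousMr.
have cqq : continuous (fun z => q.[z] * q.[z]) by exact: continuousMr.
have cww : continuous (fun z => w z * w z) by exact: continuousMr.
have -> : \int[mu]_(z in `[0, D]) ((w z - q.[z]) ^+ 2) =
  \int[mu]_(z in `[0, D]) (w z * w z) + (-2) * \int[mu]_(z in `[0, D]) (q.[z] * w z) + ip q q.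
  have c2 : continuous (fun z => (-2) * (q.[z] * w z)).
    by apply: (@continuousMr R R (cst (-2))) => //; exact: cst_continuous.
  rewrite -Rintegral_itvZ// -Rintegral_itvD// -Rintegral_itvD//; last first.
    by move=> z; apply: cvgD; [exact: cww|exact: c2].
  by apply: eq_Rintegral => z _; ring.
rewrite qw qq.
have -> : \int[mu]_(z in `[0, D]) (w z ^+ 2) = \int[mu]_(z in `[0, D]) (w z * w z).
  by apply: eq_Rintegral => z _; rewrite expr2.
lra.
Qed.

End Legendre.

(** * Derivatives of polynomial moments over a sliding window *)

Section Moments.
Context {R : realType}.
Local Notation mu := (@lebesgue_measure R).
Local Open Scope classical_set_scope.
Implicit Types (w : R -> R) (p : {poly R}).

Lemma continuous_shiftr w t : continuous w -> continuous (fun z => w (z + t)).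
Proof.
move=> cw z; apply: (@continuous_comp _ _ _ (fun z => z + t) w); last exact: cw.
by apply: cvgD; [exact: cvg_id|exact: cvg_cst].
Qed.

Lemma is_derive_window w (D t : R) : 0 < D -> continuous w ->
  is_derive t (1 : R) (fun s => \int[mu]_(z in `[0, D]) w (z + s)) (w (D + t) - w t).
Proof.
(* Any base point below [t] would do: it must lie strictly to the left of every point where the
   primitive is differentiated. *)
move=> D0 cw; pose a := t - 1; pose W x := \int[mu]_(s in `[a, x]) w s.
have dW x : a < x -> is_derive x (1 : R) W (w x) by exact: is_derive_primitive.
have ta : a < t by rewrite /a; lra.
have d1 : is_derive t (1 : R) (fun s => W (D + s)) (w (D + t)).
  have := @is_derive1_comp R W (fun s => D + s) t (w (D + t)) (0 + 1).
  rewrite add0r mulr1; apply; first by apply: dW; rewrite /a; lra.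
  have := is_derive1D (cst D) id t 0 1 (is_derive_cst _ _ _) (is_derive_id _ _).
  by rewrite add0r.
have d2 := is_derive1D _ _ _ _ _ d1 (is_derive1Z _ _ (-1) _ (dW t ta)).
rewrite mulN1r in d2.
apply: (near_eq_is_derive _ d2); near=> s.
have as_ : a < s by near: s; exact: lt_nbhsr.
rewrite Rintegral_shift; last exact: continuousT_integrable_itv.
rewrite add0r /W (@Rintegral_itv_split _ a s (D + s)); last first.
- exact: continuousT_integrable_itv.
- by lra.
- exact: ltW.
ring.
Unshelve. all: by end_near. Qed.

(** This is integration by parts for a [w] that is continuous but possibly not differentiable. The
    induction on [p] varies [w]: with [w1 s = s * w s], the identity [z * w (z + s) = w1 (z + s) - s
    * w (z + s)] trades a factor [z] for a change of [w], until only the plain window integral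
    remains. *)
Lemma is_derive_moment (D t : R) p w : 0 < D -> continuous w ->
  is_derive t (1 : R) (fun s => \int[mu]_(z in `[0, D]) (p.[z] * w (z + s)))
    (p.[D] * w (D + t) - p.[0] * w t -
     \int[mu]_(z in `[0, D]) (p^`().[z] * w (z + t))).
Proof.
move=> D0; elim/poly_ind: p w => [|q c IH] w cw.
  have -> : (fun s => \int[mu]_(z in `[0, D]) ((0 : {poly R}).[z] * w (z + s))) = cst 0.
    apply/funext => s; rewrite (_ : (fun z => _) = cst 0) ?Rintegral_cst ?mul0r//.
    by apply/funext => z; rewrite horner0 mul0r.
  rewrite deriv0 !horner0 !mul0r subrr sub0r.
  rewrite (_ : (fun z => _) = cst 0) ?Rintegral_cst ?mul0r ?oppr0//.
    exact: is_derive_cst.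
  by apply/funext => z; rewrite horner0 mul0r.
pose w1 s := s * w s.
have cw1 : continuous w1 by apply: continuousMr => // x; exact: cvg_id.
have chp r : continuous (fun z : R => (r : {poly R}).[z]) by exact: continuous_horner.
have cs s v : continuous v -> continuous (fun z : R => (v : R -> R) (z + s)).
  exact: continuous_shiftr.
have cI r v s : continuous v -> continuous (fun z : R => (r : {poly R}).[z] * (v : R -> R) (z + s)).
  by move=> cv; apply: continuousMr => //; exact: cs.
pose J r v s := \int[mu]_(z in `[0, D]) ((r : {poly R}).[z] * (v : R -> R) (z + s)).
have split1 r s : \int[mu]_(z in `[0, D]) ((r.[z] * z) * w (z + s)) =
    J r w1 s - s * J r w s.
  rewrite /J -mulNr -Rintegral_itvZ; last exact: cI.
  rewrite -Rintegral_itvD; [|exact: cI|]; last first.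
    by apply: (@continuousMr R R (cst (- s))); [exact: cst_continuous|exact: cI].
  by apply: eq_Rintegral => z _; rewrite /w1; ring.
have e1 : (fun s => \int[mu]_(z in `[0, D]) ((q * 'X + c%:P).[z] * w (z + s))) =
    (fun s => J q w1 s + (-1) * (s * J q w s)
       + c * \int[mu]_(z in `[0, D]) w (z + s)).
  apply/funext => s; rewrite mulN1r -split1 -Rintegral_itvZ; last exact: cs.
  have cqz : continuous (fun z : R => q.[z] * z * w (z + s)).
    apply: continuousMr; last exact: cs.
    by apply: continuousMr => // z; exact: cvg_id.
  rewrite -Rintegral_itvD//; last first.
    by apply: (@continuousMr R R (cst c)); [exact: cst_continuous|exact: cs].
  by apply: eq_Rintegral => z _; rewrite !hornerE; ring.
rewrite e1.
have := is_derive1D _ _ _ _ _ (is_derive1D _ _ _ _ _ (IH w1 cw1)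
  (is_derive1Z _ _ (-1) _ (is_derive1M _ _ _ _ _ (is_derive_id t (1 : R)) (IH w cw))))
  (is_derive1Z _ _ c _ (is_derive_window w D t D0 cw)).
move=> H; apply: (is_derive_eq H).
have e2 : \int[mu]_(z in `[0, D]) ((q * 'X + c%:P)^`().[z] * w (z + t)) =
   J (deriv q) w1 t - t * J (deriv q) w t + J q w t.
  rewrite -split1 /J -Rintegral_itvD; [| |exact: cI]; last first.
    apply: continuousMr; last exact: cs.
    by apply: continuousMr => // z; exact: cvg_id.
  by apply: eq_Rintegral => z _; rewrite derivD derivM derivX derivC !hornerE mulrDl.
rewrite e2 /w1 /J !hornerMXaddC; ring.
Qed.

End Moments.

(** * Boundedness on [0, D] *)

Section EarlyBound.
Context {R : realType}.
Local Notation mu := (@lebesgue_measure R).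
Local Open Scope classical_set_scope.

(** Cauchy-Schwarz, read off from the nonnegative integral of [(g s - k) ^+ 2] over [[0, t]].
    Dividing by [D] instead of [t] in [k] avoids the degenerate case [t = 0] and costs only
    [k ^+ 2 * t <= k ^+ 2 * D]. *)
Lemma sqr_Rintegral_le (D t : R) (g : R -> R) : 0 < D -> 0 <= t <= D ->
  mu.-integrable `[0, D] (EFin \o g) ->
  mu.-integrable `[0, D] (EFin \o (fun s => g s ^+ 2)) ->
  (\int[mu]_(s in `[0, t]) g s) ^+ 2 <= D * \int[mu]_(s in `[0, D]) g s ^+ 2.
Proof.
move=> D0 /andP[t0 tD] ig ig2.
pose v := \int[mu]_(s in `[0, t]) g s; pose k := v / D.
have igt : mu.-integrable `[0, t] (EFin \o g) by exact: integrable_itvS ig.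
have ig2t : mu.-integrable `[0, t] (EFin \o (fun s => g s ^+ 2)) by exact: integrable_itvS ig2.
have ict (r : R) : mu.-integrable `[0, t] (EFin \o (fun=> r)).
  by apply: continuousT_integrable_itv; exact: cst_continuous.
have ikt : mu.-integrable `[0, t] (EFin \o (fun s => (- 2 * k) * g s)).
  by apply: eq_integrable (integrableZl _ (- 2 * k) igt).
have : 0 <= \int[mu]_(s in `[0, t]) (g s - k) ^+ 2.
  by apply: Rintegral_ge0 => s _; exact: sqr_ge0.
have -> : \int[mu]_(s in `[0, t]) (g s - k) ^+ 2 =
    \int[mu]_(s in `[0, t]) (g s ^+ 2) + (- 2 * k) * v + k ^+ 2 * t.
  have iD : mu.-integrable `[0, t] (EFin \o (fun s => g s ^+ 2 + (- 2 * k) * g s)).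
    by apply: eq_integrable (integrableD _ ig2t ikt).
  transitivity (\int[mu]_(s in `[0, t]) ((g s ^+ 2 + (- 2 * k) * g s) + k ^+ 2)).
    by apply: eq_Rintegral => s _; ring.
  rewrite (RintegralD _ iD (ict _))// (RintegralD _ ig2t ikt)// RintegralZl//.
  rewrite Rintegral_cst//; congr (_ + _ * _).
  rewrite /= lebesgue_measure_itv/= lte_fin; case: ltP => [_|t0'] /=; first by rewrite subr0.
  by have -> : t = 0 by lra.
have mt : \int[mu]_(s in `[0, t]) (g s ^+ 2) <= \int[mu]_(s in `[0, D]) (g s ^+ 2).
  rewrite (@Rintegral_itv_split _ 0 t D)// lerDl; apply: Rintegral_ge0 => s _.
  exact: sqr_ge0.
have vk : v = k * D by rewrite /k mulfVK// gt_eqF.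
have k2 : k ^+ 2 * t <= k ^+ 2 * D by rewrite ler_wpM2l// sqr_ge0.
rewrite -/v; move: mt k2; move: (\int[mu]_(s in `[0, t]) _) => p.
move: (\int[mu]_(s in `[0, D]) _) => q; rewrite vk => pq k2 H.
have : k ^+ 2 * D <= q by nra.
have -> : (k * D) ^+ 2 = D * (k ^+ 2 * D) by ring.
by move=> kq; rewrite ler_wpM2l// ltW.
Qed.

Variables (n N : nat) (A : 'M[R]_n) (B : 'cV[R]_n) (F : 'M[R]_N) (G : 'M[R]_(N, n)).
Variable D : R.
Hypothesis D_gt0 : 0 < D.

Definition integrated_plant (X : R -> 'cV[R]_n) (g : R -> R) : Prop :=
  forall (t : R) i, 0 <= t -> X t i 0 =
    X 0 i 0 + \int[mu]_(s in `[0, t]) (A *m X s + g s *: B) i 0.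

Definition controller_ode (X : R -> 'cV[R]_n) (uh : R -> 'cV[R]_N) : Prop :=
  forall (t : R) j, 0 < t -> is_derive t (1 : R) (fun s => uh s j 0) ((F *m uh t + G *m X t) j 0).

Lemma continuous_mulmx (p q : nat) (M : 'M[R]_(p, q)) (x : R -> 'cV[R]_q) :
  (forall i, continuous (fun t => x t i 0)) -> forall i, continuous (fun t => (M *m x t) i 0).
Proof.
move=> cx i; have -> : (fun t => (M *m x t) i 0) = (fun t => \sum_j M i j * x t j 0).
  by apply/funext => t; rewrite mxE.
apply: continuous_sumr => j; apply: continuousMr; first exact: cst_continuous.
exact: cx.
Qed.

Definition early_trajectory (X : R -> 'cV[R]_n) (uh : R -> 'cV[R]_N) (g : R -> R) : Prop :=
  [/\ (forall i, continuous (fun t => X t i 0)) /\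
      (forall j, continuous (fun t => uh t j 0)),
      mu.-integrable `[0, D] (EFin \o g),
      mu.-integrable `[0, D] (EFin \o (fun s => g s ^+ 2)),
      integrated_plant X g & controller_ode X uh].

(* X - (\int_0^t g) B is differentiable although X itself, driven by an L^2
   input, need not be; Gronwall is applied to the former. *)
Lemma early_bound : exists2 C : R, 0 <= C &
  forall X uh g, early_trajectory X uh g ->
  forall t : R, 0 <= t <= D -> sqnorm (X t) + sqnorm (uh t) <=
    C * (sqnorm (X 0) + sqnorm (uh 0) + \int[mu]_(s in `[0, D]) g s ^+ 2).
Proof.
have [a a0 aE] := sqnorm_mulmx_le A.
have [f f0 fE] := sqnorm_mulmx_le F.
have [e e0 eE] := sqnorm_mulmx_le G.
(* With [y] the differentiable part of [X] and [m] the input energy, [b] gives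
   [sqnorm (X t) <= b * (sqnorm (y t) + m)]. The rate [k] below collects the bounds of the
   right-hand sides: [1] and [2 * f] act on [y] and [uh] themselves, while [a] and [2 * e] act on
   [X] and hence carry the factor [b]. *)
pose b := 2 + 2 * D * sqnorm B.
have DB : 0 <= D * sqnorm B by rewrite mulr_ge0 ?sqnorm_ge0// ltW.
have b2 : 2 <= b by rewrite /b -mulrA; lra.
have b0 : 0 <= b by lra.
pose k := 1 + 2 * f + (a + 2 * e) * b.
exists (b * expR (k * D)); first by rewrite mulr_ge0// expR_ge0.
move=> X uh g [[cX cuh] ig ig2 hX huh].
pose m := \int[mu]_(s in `[0, D]) g s ^+ 2.
have m0 : 0 <= m by apply: Rintegral_ge0 => s _; exact: sqr_ge0.
pose gam t := \int[mu]_(s in `[0, t]) g s.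
pose y t : 'cV[R]_n := \col_i (X 0 i 0 + \int[mu]_(s in `[0, t]) (A *m X s) i 0).
have cAX i : continuous (fun s => (A *m X s) i 0) by exact: continuous_mulmx.
have XE t : 0 <= t <= D -> X t = y t + gam t *: B.
  move=> /andP[t0 tD]; apply/colP => i; rewrite hX// !mxE -addrA; congr (_ + _).
  have igt : mu.-integrable `[0, t] (EFin \o g) by exact: integrable_itvS ig.
  rewrite /gam -RintegralZr// -RintegralD//; last 2 first.
  - exact: continuousT_integrable_itv.
  - by apply: eq_integrable (integrableZr _ (B i 0) igt).
  by apply: eq_Rintegral => s _; rewrite mxE [X in _ + X]mxE.
have XB t : 0 <= t <= D -> sqnorm (X t) <= b * (sqnorm (y t) + m).
  move=> tD; rewrite XE//; apply: (le_trans (sqnormD _ _)); rewrite sqnormZ.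
  have := sqr_Rintegral_le D t g D_gt0 tD ig ig2; rewrite -/m -/(gam t).
  have := sqnorm_ge0 B; have := sqnorm_ge0 (y t); move: DB; rewrite /b.
  move: (sqnorm B) (sqnorm (y t)) (gam t ^+ 2) => B2 y2 g2 DB2 y20 B20 g2m.
  have := ler_wpM2r B20 g2m; have := mulr_ge0 DB2 y20.
  have -> : (2 + 2 * D * B2) * (y2 + m) =
    2 * y2 + 2 * m + 2 * (D * B2 * y2) + 2 * (D * m * B2) by ring.
  lra.
(* Adding the constant [m] absorbs the forcing by the input, so that the differential inequality
   [dV t <= k * V t] is homogeneous. *)
pose V t := sqnorm (y t) + sqnorm (uh t) + m.
pose dV t := \sum_i 2 * (y t i 0 * (A *m X t) i 0) +
   \sum_i 2 * (uh t i 0 * (F *m uh t + G *m X t) i 0) + 0.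
have dVE t : 0 < t < D -> is_derive t (1 : R) V (dV t).
  move=> /andP[t0 tD].
  apply: (is_derive1D (fun t => sqnorm (y t) + sqnorm (uh t)) (cst m)).
  apply: (is_derive1D (fun t => sqnorm (y t)) (fun t => sqnorm (uh t)));
    apply: is_derive_sqnorm; last by move=> j; exact: huh.
  move=> i; have -> : (fun s => y s i 0) =
      (fun s => cst (X 0 i 0) s + \int[mu]_(r in `[0, s]) (A *m X r) i 0).
    by apply/funext => s; rewrite mxE.
  have := is_derive1D _ _ _ _ _ (is_derive_cst (X 0 i 0) t (1 : R))
    (is_derive_primitive 0 _ t (cAX i) t0).
  by rewrite add0r.
have cV : {within `[0, D], continuous V}.
  move=> t; apply: cvgD; last exact: cvg_cst.
  apply: cvgD.
    apply: (@continuous_sqnorm R n (subspace `[0, D]) y) => i.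
    have -> : (fun s => y s i 0) =
      (fun s => X 0 i 0 + \int[mu]_(r in `[0, s]) (A *m X r) i 0).
      by apply/funext => s; rewrite mxE.
    move=> s; apply: cvgD; first exact: cvg_cst.
    apply: (parameterized_integral_continuous (ltW D_gt0)).
    exact: continuousT_integrable_itv.
  apply: (@continuous_sqnorm R N (subspace `[0, D]) uh) => j.
  exact: (continuous_subspaceT (cuh j)).
have dVle t : 0 < t < D -> dV t <= k * V t.
  move=> /andP[t0 tD]; have tI : 0 <= t <= D by rewrite !ltW.
  have H1 := dot_le_sqnorm (y t) (A *m X t).
  have H2 := dot_le_sqnorm (uh t) (F *m uh t + G *m X t).
  have H3 := sqnormD (F *m uh t) (G *m X t).
  have := aE (X t); have := fE (uh t); have := eE (X t); have := XB t tI.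
  have := sqnorm_ge0 (X t); have := sqnorm_ge0 (uh t); have := sqnorm_ge0 (y t).
  rewrite /dV /V /k addr0; move: H1 H2 H3.
  move: (\sum_i 2 * (y t i 0 * _)) (\sum_i 2 * (uh t i 0 * _)) => s1 s2.
  move: (sqnorm (A *m X t)) (sqnorm (F *m uh t + _)) (sqnorm (F *m uh t)) (sqnorm (G *m X t)).
  move=> q1 q2 q3 q4.
  move: (sqnorm (X t)) (sqnorm (uh t)) (sqnorm (y t)) => x2 u2 y2.
  move=> H1 H2 H3 y20 u20 x20 Hx Hg Hf Ha.
  have Hx1 : a * x2 <= a * (b * (y2 + m)) by rewrite ler_wpM2l// ltW.
  have Hx2 : e * x2 <= e * (b * (y2 + m)) by rewrite ler_wpM2l// ltW.
  have Hb : 0 <= (a + 2 * e) * b * u2 by rewrite !mulr_ge0//; lra.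
  have Hf' : 0 <= f * (y2 + m) by rewrite mulr_ge0//; lra.
  nra.
move=> t tD.
have := exponential_comparison V dV 0 D k cV dVE dVle t tD; rewrite subr0 => Vt.
have k0 : 0 <= k by rewrite /k addr_ge0 ?mulr_ge0//; lra.
have ekt : expR (k * t) <= expR (k * D).
  by rewrite ler_expR ler_wpM2l//; case/andP: tD.
have V0 : V 0 = sqnorm (X 0) + sqnorm (uh 0) + m.
  rewrite /V; congr (sqnorm _ + _ + _); apply/colP => i.
  by rewrite mxE Rintegral_itv_xx addr0.
rewrite -/m -V0 -mulrA; apply: (@le_trans _ _ (b * V t)).
  rewrite /V; have := XB t tD; have := sqnorm_ge0 (uh t).
  nra.
rewrite ler_wpM2l// (le_trans Vt)// ler_wpM2r// V0.
by rewrite !addr_ge0// sqnorm_ge0.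
Qed.

End EarlyBound.

(** * Lyapunov decay after time D *)

Section LateDecay.
Context {R : realType}.
Local Notation mu := (@lebesgue_measure R).
Local Open Scope classical_set_scope.

(* With the matrices of the LMI the left-hand side is the quadratic form Lambda,
   and dx is the derivative of the augmented state x when the outflow is v. *)
Lemma qform_extended m (A P Q : 'M[R]_m) (b1 b2 : 'cV[R]_m) (k : 'rV[R]_m)
    (a d1 d2 v : R) (x : 'cV[R]_m) :
  let f := (k *m x) 0 0 in
  let dx := A *m x + f *: b1 + v *: b2 in
  qform (block_mx (A^T *m P + P *m A + d1 *: (k^T *m k) - d2 *: Q
                   + P *m b1 *m k + k^T *m b1^T *m P)
                  (P *m b2) (b2^T *m P) (- a)%:M) (col_mx x v%:M) =
  (dx^T *m P *m x + x^T *m P *m dx) 0 0 + d1 * f ^+ 2 - d2 * qform Q x - a * v ^+ 2.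
Proof.
move=> f dx.
have kx : k *m x = f%:M by exact: mx11_scalar.
have xk : x^T *m k^T = f%:M by rewrite -trmx_mul kx tr_scalar_mx.
have dxT : dx^T = x^T *m A^T + f *: b1^T + v *: b2^T.
  by rewrite /dx !raddfD/= !linearZ/= trmx_mul.
have eD (M M' : 'M[R]_1) : (M + M') 0 0 = M 0 0 + M' 0 0 by rewrite mxE.
have eN (M : 'M[R]_1) : (- M) 0 0 = - M 0 0 by rewrite mxE.
have eZ (c : R) (M : 'M[R]_1) : (c *: M) 0 0 = c * M 0 0 by rewrite mxE.
have eS (c : R) : (c%:M : 'M[R]_1) 0 0 = c by rewrite mxE eqxx mulr1n.
rewrite dxT /dx /qform tr_col_mx tr_scalar_mx mul_row_block mul_row_col.
rewrite !(mulmxDl, mulmxDr, mulNmx, mulmxN, mul_scalar_mx, mul_mx_scalar, mulmxA).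
rewrite -!(scalemxAl, scalemxAr) xk.
rewrite !(mulmxDl, mulmxDr, mulNmx, mulmxN, mul_scalar_mx, mul_mx_scalar, mulmxA).
rewrite -[_ *m k *m x]mulmxA kx mul_mx_scalar.
rewrite -!(scalemxAl, scalemxAr) xk mul_scalar_mx -scalemxAl kx.
rewrite !(eD, eN, eZ, eS).
ring.
Qed.

Lemma col_mx_ind (m p : nat) (Pr : 'I_(m + p) -> Prop) :
  (forall i, Pr (lshift p i)) -> (forall i, Pr (rshift m i)) -> forall i, Pr i.
Proof. by move=> Pl Pr' i; case: (split_ordP i) => j ->. Qed.

Variables (n N l : nat) (A : 'M[R]_n) (B : 'cV[R]_n) (K : 'rV[R]_n) (D : R).
Hypothesis D_gt0 : 0 < D.
Variables (X : R -> 'cV[R]_n) (uh : R -> 'cV[R]_N) (w : R -> R).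
Hypothesis X_continuous : forall i, continuous (fun t => X t i 0).
Hypothesis uh_continuous : forall j, continuous (fun t => uh t j 0).
Hypothesis w_continuous : continuous w.
Hypothesis X_ode : forall t i, D < t ->
  is_derive t (1 : R) (fun s => X s i 0) ((A *m X t + w t *: B) i 0).
Hypothesis uh_ode : forall t j, D < t ->
  is_derive t (1 : R) (fun s => uh s j 0)
    ((tAd A B K D N *m uh t + tBd A K D N *m X t) j 0).
Hypothesis w_feedback : forall t, D <= t ->
  w (D + t) = (K1 A B K D N *m uh t + K2 A K D *m X t) 0 0.

(** [w] is the outflow as a function of time, and the profile at time [t] is [w (z + t)]; thus [w t]
    enters the plant and [w (D + t)] is the boundary input. *)
Definition legendre_moments t : 'cV[R]_l :=
  \col_k \int[mu]_(z in `[0, D]) ((legendre D k).[z] * w (z + t)).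

Definition augmented t : 'cV[R]_(n + N + l) :=
  col_mx (col_mx (X t) (uh t)) (legendre_moments t).

Lemma Kbar_augmented t : D <= t ->
  (Kbar A B K D N l *m augmented t) 0 0 = w (D + t).
Proof.
by move=> Dt; rewrite w_feedback// /Kbar /augmented !mul_row_col mul0mx addr0 addrC.
Qed.

Lemma is_derive_augmented t i : D < t ->
  is_derive t (1 : R) (fun s => augmented s i 0)
    ((calA A B K D N l *m augmented t + w (D + t) *: calB1 n N l
      + w t *: calB2 B N l) i 0).
Proof.
move=> Dt.
have -> : calA A B K D N l *m augmented t + w (D + t) *: calB1 n N l
   + w t *: calB2 B N l = col_mx (col_mx (A *m X t + w t *: B)
    (tAd A B K D N *m uh t + tBd A K D N *m X t))
   (- (D^-1 *: legM l *m legendre_moments t) + w (D + t) *: legLD l - w t *: legL0 l).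
  rewrite /calA /augmented /calB1 /calB2 !mul_block_col !scale_col_mx !add_col_mx.
  rewrite !mul0mx !scaler0 !addr0 !add0r mulNmx scalerN.
  by rewrite [tBd _ _ _ _ *m _ + _]addrC !add_col_mx !addr0.
elim/col_mx_ind: i => [i|k].
  have -> : (fun s => augmented s (lshift l i) 0) = (fun s => col_mx (X s) (uh s) i 0).
    by apply/funext => s; rewrite /augmented col_mxEu.
  rewrite col_mxEu; elim/col_mx_ind: i => [i|j].
    have -> : (fun s => col_mx (X s) (uh s) (lshift N i) 0) = (fun s => X s i 0).
      by apply/funext => s; rewrite col_mxEu.
    by rewrite col_mxEu; exact: X_ode.
  have -> : (fun s => col_mx (X s) (uh s) (rshift n j) 0) = (fun s => uh s j 0).
    by apply/funext => s; rewrite col_mxEd.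
  by rewrite col_mxEd; exact: uh_ode.
have -> : (fun s => augmented s (rshift (n + N) k) 0) =
    (fun s => \int[mu]_(z in `[0, D]) ((legendre D k).[z] * w (z + s))).
  by apply/funext => s; rewrite /augmented col_mxEd mxE.
rewrite col_mxEd.
apply: (is_derive_eq (is_derive_moment D t (legendre D k) w D_gt0 w_continuous)).
rewrite legendre_right// legendre_left// mul1r.
have -> : \int[mu]_(z in `[0, D]) (((legendre D k)^`()).[z] * w (z + t)) =
    \sum_i (D^-1 * legM l k i) * legendre_moments t i 0.
  rewrite deriv_legendre//.
  under eq_Rintegral do rewrite horner_sum mulr_suml.
  rewrite Rintegral_itv_sum; last first.
    move=> i; apply: continuousMr; first exact: continuous_horner.
    exact: continuous_shiftr.
  apply: eq_bigr => i _; rewrite [legendre_moments _ _ _]mxE -Rintegral_itvZ; last first.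
    apply: continuousMr; first exact: continuous_horner.
    exact: continuous_shiftr.
  by apply: eq_Rintegral => z _; rewrite hornerZ mulrA.
have HU : (D^-1 *: legM l *m legendre_moments t) k 0 =
    \sum_i (D^-1 * legM l k i) * legendre_moments t i 0.
  by rewrite mxE; apply: eq_bigr => i _; congr (_ * _); exact: mxE.
have eD (M M' : 'cV[R]_l) : (M + M') k 0 = M k 0 + M' k 0 by rewrite mxE.
have eN (M : 'cV[R]_l) : (- M) k 0 = - M k 0 by rewrite mxE.
have eZ (c : R) (M : 'cV[R]_l) : (c *: M) k 0 = c * M k 0 by rewrite mxE.
have eLD : legLD l k 0 = 1 :> R by rewrite mxE.
have eL0 : legL0 l k 0 = (-1) ^+ k :> R by rewrite mxE.
rewrite !(eD, eN, eZ) HU eLD eL0; ring.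
Qed.

End LateDecay.

(** * Exponential decay of the Lyapunov functional *)

Section LateDecayEstimate.
Context {R : realType}.
Local Notation mu := (@lebesgue_measure R).
Local Open Scope classical_set_scope.
Variables (n N l : nat) (A : 'M[R]_n) (B : 'cV[R]_n) (K : 'rV[R]_n) (D : R).
Hypothesis D_gt0 : 0 < D.

Lemma qform_Qbar (x : 'cV[R]_(n + N)) (y : 'cV[R]_l) :
  qform (Qbar n N l) (col_mx x y) = \sum_(k < l) (2 * k + 1)%:R * y k 0 ^+ 2.
Proof.
rewrite /qform /Qbar tr_col_mx mul_row_block !mulmx0 !add0r mul_row_col mul0mx add0r.
rewrite mxE; apply: eq_bigr => k _; rewrite /legQ mul_mx_diag !mxE; ring.
Qed.

Definition window_energy (X : R -> 'cV[R]_n) (uh : R -> 'cV[R]_N) (w : R -> R) (t : R) :=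
  sqnorm (X t) + sqnorm (uh t) + \int[mu]_(z in `[0, D]) w (z + t) ^+ 2.

Let window_sqr (w : R -> R) (t : R) (p : {poly R}) : continuous w ->
  continuous (fun z => p.[z] * w (z + t) ^+ 2).
Proof.
move=> cw; apply: continuousMr; first exact: continuous_horner.
have := @continuous_shiftr R (fun s => w s ^+ 2) t; apply => s.
apply: (@continuous_comp _ _ _ w (fun y : R => y ^+ 2)); first exact: cw.
exact: exprn_continuous.
Qed.

(** The properties are bundled so that the constants of the decay estimate can be chosen before the
    trajectory; stability needs them uniform over all solutions. *)
Definition late_trajectory (X : R -> 'cV[R]_n) (uh : R -> 'cV[R]_N) (w : R -> R) : Prop :=
  [/\ (forall i, continuous (fun t => X t i 0)) /\
      (forall j, continuous (fun t => uh t j 0)),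
      continuous w,
      forall t i, D < t ->
        is_derive t (1 : R) (fun s => X s i 0) ((A *m X t + w t *: B) i 0),
      forall t j, D < t ->
        is_derive t (1 : R) (fun s => uh s j 0)
          ((tAd A B K D N *m uh t + tBd A K D N *m X t) j 0) &
      forall t, D <= t ->
        w (D + t) = (K1 A B K D N *m uh t + K2 A K D *m X t) 0 0].

Lemma late_decay (P : 'M[R]_(n + N + l)) (alpha : R) :
  posdef P -> 0 < alpha -> negdef (Lambda A B K D P alpha) ->
  exists C c : R, [/\ 0 <= C, 0 < c &
  forall X uh w, late_trajectory X uh w -> forall t, D <= t ->
    window_energy X uh w t <= C * expR (- c * (t - D)) * window_energy X uh w D].
Proof.
move=> P0 al0 L0.
have [c0 c00 c0E] : exists2 c0 : R, 0 < c0 &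
    forall x, qform (Lambda A B K D P alpha) x <= - c0 * sqnorm x.
  have [|c0 c00 c0E] := @posdef_ge R _ (- Lambda A B K D P alpha).
    by move=> x x0; rewrite mulmxN mulNmx mxE oppr_gt0; exact: L0.
  exists c0 => // x; have := c0E x.
  by rewrite /qform mulmxN mulNmx mxE; lra.
have [p p0 pE] := posdef_ge P P0.
have [q q0 qE] := qform_le P.
pose s1 : R := (2 * l + 1)%:R / D.
have s10 : 0 <= s1 by rewrite /s1 divr_ge0// ltW.
(* [ep <= alpha] keeps the coefficient [alpha - ep] of Bessel's inequality nonnegative.
   [ep * (s1 + 1) <= c0] lets the margin [c0] of Lambda on the moments absorb [ep * S t], which is
   at most [ep * s1 * sqnorm (U t)]. *)
pose ep := Num.min alpha (c0 / (s1 + 1)).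
have s11 : 0 < s1 + 1 by lra.
have ep0 : 0 < ep by rewrite /ep lt_min al0 divr_gt0.
have epal : ep <= alpha by rewrite /ep ge_min lexx.
have epc : ep * (s1 + 1) <= c0.
  by rewrite -ler_pdivlMr// /ep ge_min lexx orbT.
(* [m] and [M] are the constants of the equivalence between V and the window energy. The lower bound
   uses 1 + z >= 1; the upper one uses 1 + z <= 1 + D and the fact that the moments have squared
   norm at most [D] times the energy of the profile. The rate is then [ep / M] and the overshoot
   [M / m]. *)
pose m := Num.min p alpha.
have m0 : 0 < m by rewrite /m lt_min p0.
have mp : m <= p by rewrite /m ge_min lexx.
have mal : m <= alpha by rewrite /m ge_min lexx orbT.
pose M := (q + alpha) * (1 + D).
have M0 : 0 < M by rewrite /M mulr_gt0 ?addr_gt0//.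
exists (M / m), (ep / M); split; [by rewrite divr_ge0// ltW|by rewrite divr_gt0|].
move=> X uh w [[cX cuh] cw dX duh wE].
pose U := legendre_moments l D w.
pose xi := augmented n N l D X uh w.
pose I t := \int[mu]_(z in `[0, D]) (w (z + t) ^+ 2).
pose J t := \int[mu]_(z in `[0, D]) ((1 + 'X : {poly R}).[z] * w (z + t) ^+ 2).
pose S t := \sum_(k < l) (2 * k + 1)%:R / D * U t k 0 ^+ 2.
have cw2 : continuous (fun s => w s ^+ 2).
  move=> s; apply: (@continuous_comp _ _ _ w (fun y : R => y ^+ 2)); first exact: cw.
  exact: exprn_continuous.
have cI t : continuous (fun z => w (z + t) ^+ 2).
  exact: (@continuous_shiftr R (fun s => w s ^+ 2) t cw2).
have xiE t : sqnorm (xi t) = sqnorm (X t) + sqnorm (uh t) + sqnorm (U t).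
  by rewrite /xi /augmented !sqnorm_col_mx.
have SI t : S t <= I t.
  have := bessel_legendre D D_gt0 l (fun z => w (z + t)) (continuous_shiftr w t cw).
  apply: le_trans; rewrite le_eqVlt; apply/orP; left; apply/eqP.
  by apply: eq_bigr => k _; rewrite /U mxE.
have DK (a b : R) : D * (a / D * b) = a * b.
  by field; rewrite gt_eqF.
have US t : sqnorm (U t) <= D * S t.
  rewrite /S mulr_sumr; apply: ler_sum => k _.
  rewrite DK -[leLHS]mul1r ler_wpM2r ?sqr_ge0//.
  by rewrite ler1n addn1.
have SU t : S t <= s1 * sqnorm (U t).
  rewrite /S /sqnorm mulr_sumr; apply: ler_sum => k _; rewrite ler_wpM2r ?sqr_ge0//.
  rewrite /s1 ler_wpM2r ?invr_ge0 ?(ltW D_gt0)//.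
  by rewrite ler_nat leq_add2r leq_mul2l ltnW.
have IJ t : I t <= J t.
  apply: le_Rintegral => //; [exact: continuousT_integrable_itv| |].
    by apply: continuousT_integrable_itv; exact: window_sqr.
  move=> z; rewrite /= in_itv/= => /andP[z0 _]; rewrite hornerD hornerC hornerX.
  by rewrite -[leLHS]mul1r ler_wpM2r ?sqr_ge0// lerDl.
have JI t : J t <= (1 + D) * I t.
  rewrite /I -Rintegral_itvZ; last exact: cI.
  apply: le_Rintegral => //.
  - by apply: continuousT_integrable_itv; exact: window_sqr.
  - apply: continuousT_integrable_itv; apply: (@continuousMr R R (cst (1 + D))); last exact: cI.
    exact: cst_continuous.
  move=> z; rewrite /= in_itv/= => /andP[_ zD]; rewrite hornerD hornerC hornerX.
  by rewrite ler_wpM2r ?sqr_ge0// lerD2l.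
have I0 t : 0 <= I t by apply: Rintegral_ge0 => z _; exact: sqr_ge0.
pose V t := qform P (xi t) + alpha * J t.
pose dxi t := calA A B K D N l *m xi t + w (D + t) *: calB1 n N l + w t *: calB2 B N l.
pose dV t := ((dxi t)^T *m P *m xi t + (xi t)^T *m P *m dxi t) 0 0 +
  alpha * ((1 + D) * w (D + t) ^+ 2 - w t ^+ 2 - I t).
have dJ t : is_derive t (1 : R) J ((1 + D) * w (D + t) ^+ 2 - w t ^+ 2 - I t).
  have H := is_derive_moment D t (1 + 'X) (fun s => w s ^+ 2) D_gt0 cw2.
  apply: (is_derive_eq H).
  rewrite !hornerD !hornerC !hornerX derivD derivC derivX add0r addr0 mul1r.
  by congr (_ - _); apply: eq_Rintegral => z _; rewrite hornerC mul1r.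
have dVE t : D < t -> is_derive t (1 : R) V (dV t).
  move=> Dt; apply: (is_derive1D _ _ _ _ _ _ (is_derive1Z J t alpha _ (dJ t))).
  apply: is_derive_qform => i.
  exact: (is_derive_augmented n N l A B K D D_gt0 X uh w cw dX duh t i Dt).
(* Bessel's inequality bounds the Qbar term by I t; the part ep of alpha is kept
   aside, at the expense of the negativity of Lambda, to leave - ep * I t. *)
have dVle t : D < t -> dV t <= - ep * (sqnorm (X t) + sqnorm (uh t) + I t).
  move=> Dt.
  have := qform_extended _ (calA A B K D N l) P (Qbar n N l) (calB1 n N l)
    (calB2 B N l) (Kbar A B K D N l) alpha (alpha * (1 + D)) (alpha / D) (w t) (xi t).
  rewrite /= (Kbar_augmented n N l A B K D X uh w wE t (ltW Dt)).
  rewrite -/(dxi t) -/(Psi A B K D P alpha) -/(Lambda A B K D P alpha) => HL.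
  have := c0E (col_mx (xi t) (w t)%:M); rewrite HL sqnorm_col_mx xiE.
  have -> : qform (Qbar n N l) (xi t) = D * S t.
    rewrite /xi /augmented qform_Qbar /S mulr_sumr; apply: eq_bigr => k _.
    by rewrite DK.
  have := sqnorm_ge0 (w t)%:M; have := SI t; have := SU t; have := I0 t.
  have := sqnorm_ge0 (X t); have := sqnorm_ge0 (uh t); have := sqnorm_ge0 (U t).
  rewrite /dV; move: (_ 0 0) (sqnorm (w t)%:M) (sqnorm (X t)) (sqnorm (uh t)) (sqnorm (U t)).
  move: (S t) (I t) (w (D + t) ^+ 2) (w t ^+ 2) => s i f2 v2 d v x u y.
  move=> y0 u0 x0 i0 sy si v0.
  have -> : alpha / D * (D * s) = alpha * s by rewrite mulrA mulfVK// gt_eqF.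
  move=> H.
  have h1 : (alpha - ep) * s <= (alpha - ep) * i by rewrite ler_wpM2l// subr_ge0.
  have h2 : ep * s <= ep * (s1 * y) by rewrite ler_wpM2l// ltW.
  have h3 : ep * (s1 + 1) * y <= c0 * y by rewrite ler_wpM2r.
  have epc0 : ep <= c0 by have := mulr_ge0 (ltW ep0) s10; lra.
  have h4 : ep * (x + u) <= c0 * (x + u) by rewrite ler_wpM2r// addr_ge0.
  have h5 : 0 <= c0 * v by rewrite mulr_ge0// ltW.
  have h6 : 0 <= ep * y by rewrite mulr_ge0// ltW.
  nra.
have VM t : V t <= M * (sqnorm (X t) + sqnorm (uh t) + I t).
  have := le_trans (ler_norm _) (qE (xi t)); rewrite xiE /V /M.
  have := sqnorm_ge0 (X t); have := sqnorm_ge0 (uh t).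
  have := US t; have := SI t; have := JI t; have := I0 t.
  move: (sqnorm (X t)) (sqnorm (uh t)) (sqnorm (U t)) (I t) (J t) (S t) (qform P (xi t)).
  move=> x u y i j s r i0 ji si ys u0 x0 H.
  have h1 : y <= D * i by rewrite (le_trans ys)// ler_wpM2l// ltW.
  have h2 : q * y <= q * (D * i) by rewrite ler_wpM2l// ltW.
  have h3 : alpha * j <= alpha * ((1 + D) * i) by rewrite ler_wpM2l// ltW.
  have h4 : 0 <= q * D * (x + u) by rewrite !mulr_ge0 ?addr_ge0// ltW.
  have h5 : 0 <= alpha * (1 + D) * (x + u) by rewrite !mulr_ge0 ?addr_ge0// ltW.
  have h6 : 0 <= q * i by rewrite mulr_ge0// ltW.
  nra.
have Vm t : m * (sqnorm (X t) + sqnorm (uh t) + I t) <= V t.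
  have := pE (xi t); rewrite xiE /V.
  have := sqnorm_ge0 (X t); have := sqnorm_ge0 (uh t); have := sqnorm_ge0 (U t).
  have := IJ t; have := I0 t.
  move: (sqnorm (X t)) (sqnorm (uh t)) (sqnorm (U t)) (I t) (J t) (qform P (xi t)).
  move=> x u y i j r i0 ij y0 u0 x0 H.
  have h1 : m * (x + u) <= p * (x + u) by rewrite ler_wpM2r// addr_ge0.
  have h2 : m * i <= alpha * i by rewrite ler_wpM2r.
  have h3 : alpha * i <= alpha * j by rewrite ler_wpM2l// ltW.
  have h4 : 0 <= p * y by rewrite mulr_ge0// ltW.
  nra.
have cV : continuous V.
  have diffcont (f : R -> R) (t a : R) : is_derive t (1 : R) f a -> {for t, continuous f}.
    by move=> df; apply: differentiable_continuous; apply/derivable1_diffP; exact: ex_derive.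
  move=> t; apply: cvgD; last first.
    by apply: cvgM; [exact: cvg_cst|exact: diffcont (dJ t)].
  apply: continuous_qform => i {}t; elim/col_mx_ind: i => [i|k].
    have -> : (fun s => xi s (lshift l i) 0) = (fun s => col_mx (X s) (uh s) i 0).
      by apply/funext => s; rewrite /xi /augmented col_mxEu.
    elim/col_mx_ind: i => [i|j].
      have -> : (fun s => col_mx (X s) (uh s) (lshift N i) 0) = (fun s => X s i 0).
        by apply/funext => s; rewrite col_mxEu.
      exact: cX.
    have -> : (fun s => col_mx (X s) (uh s) (rshift n j) 0) = (fun s => uh s j 0).
      by apply/funext => s; rewrite col_mxEd.
    exact: cuh.
  have -> : (fun s => xi s (rshift (n + N) k) 0) =
      (fun s => \int[mu]_(z in `[0, D]) ((legendre D k).[z] * w (z + s))).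
    by apply/funext => s; rewrite /xi /augmented col_mxEd mxE.
  exact: diffcont (is_derive_moment D t (legendre D k) w D_gt0 cw).
move=> t Dt.
have Ve : V t <= expR (- (ep / M) * (t - D)) * V D.
  apply: (exponential_comparison V dV D t) => //.
  - by apply: continuous_subspaceT => s; exact: cV.
  - by move=> s /andP[Ds _]; exact: dVE.
  - move=> s /andP[Ds _]; apply: (le_trans (dVle s Ds)).
    rewrite !mulNr lerN2 mulrAC ler_pdivrMr// -mulrA.
    by rewrite ler_wpM2l ?(ltW ep0)// [leRHS]mulrC VM.
  - by rewrite Dt lexx.
have e0 : 0 < expR (- (ep / M) * (t - D)) by exact: expR_gt0.
rewrite /window_energy -/(I t) -/(I D).
rewrite -(ler_pM2l m0) (le_trans (Vm t))// (le_trans Ve)//.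
have -> (e E : R) : m * (M / m * e * E) = e * (M * E).
  by field; rewrite gt_eqF.
by rewrite ler_wpM2l ?VM// ltW.
Qed.

End LateDecayEstimate.

(** * The closed loop *)

Section Extension.
Context {R : realType}.
Local Open Scope classical_set_scope.

(* Solutions are constrained at nonnegative times only; freezing them before
   time 0 makes them continuous on the whole line. *)
Definition frozen {T : Type} (h : R -> T) (t : R) : T := h (Num.max t 0).

Lemma frozenE {T : Type} (h : R -> T) t : 0 <= t -> frozen h t = h t.
Proof. by move=> t0; rewrite /frozen max_l. Qed.

Lemma frozen_continuous (h : R -> R) :
  (forall T, 0 < T -> {within `[0, T], continuous h}) -> continuous (frozen h).
Proof.
move=> ch t; have [t0|t0|->] := ltgtP t 0.
- apply: cvg_near_cst; near=> s; rewrite /frozen !max_r ?ltW//.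
  by near: s; exact: lt_nbhsl.
- have e : frozen h t = h t by rewrite frozenE// ltW.
  rewrite /continuous_at e.
  have tt1 : 0 < t + 1 by lra.
  have /(continuous_within_itvP _ tt1)[c _ _] := ch _ tt1.
  have := c t; rewrite in_itv/= t0 ltrDl ltr01 => /(_ isT).
  apply: cvg_trans; apply: near_eq_cvg; near=> s; rewrite frozenE// ltW//.
  by near: s; exact: lt_nbhsr.
- apply/left_right_continuousP; have -> : frozen h 0 = h 0 by exact: frozenE.
  split.
    apply: cvg_near_cst; near=> s.
    by rewrite /frozen max_r.
  have /(continuous_within_itvP _ ltr01)[_ c _] := ch _ ltr01.
  apply: cvg_trans c; apply: near_eq_cvg; near=> s.
  by rewrite frozenE.
Unshelve. all: by end_near. Qed.

End Extension.

(** * Uniform energy estimates for solutions of the closed loop *)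

Section ClosedLoopEstimate.
Context {R : realType}.
Local Notation mu := (@lebesgue_measure R).
Local Open Scope classical_set_scope.
Variables (n N : nat) (A : 'M[R]_n) (B : 'cV[R]_n) (K : 'rV[R]_n) (D : R).
Hypothesis D_gt0 : 0 < D.

Definition state_energy (X : R -> 'cV[R]_n) (uh : R -> 'cV[R]_N) (u : R -> R -> R)
    (t : R) : R :=
  sqnorm (X t) + sqnorm (uh t) + \int[mu]_(z in `[0, D]) (u z t ^+ 2).

Section Trajectory.
Variables (X : R -> 'cV[R]_n) (uh : R -> 'cV[R]_N) (u : R -> R -> R).
Hypothesis sol : closed_loop_solution A B K D X uh u.

Let Xe := frozen X.
Let uhe := frozen uh.
(** The boundary trace [u D] is prescribed only almost everywhere; [f] is its continuous
    representative. *)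
Let f t : R := (K1 A B K D N *m uhe t + K2 A K D *m Xe t) 0 0.
Let g := delay_line D (u^~ 0) f.

Let Xe_continuous i : continuous (fun t => Xe t i 0).
Proof.
apply: (@frozen_continuous R (fun t => X t i 0)) => T T0.
by have [_ c _] := sol_plant sol (ltW T0); exact: c.
Qed.

Let uhe_continuous j : continuous (fun t => uhe t j 0).
Proof.
apply: (@frozen_continuous R (fun t => uh t j 0)) => T T0.
have c : {within `[0, +oo[, continuous (fun t => uh t j 0)}.
  exact: (sol_controller_cont sol).
apply: continuous_subspaceW c => t /=.
by rewrite !in_itv/= andbT => /andP[].
Qed.

Let f_continuous : continuous f.
Proof.
have -> : f = fun t => (K1 A B K D N *m uhe t) 0 0 + (K2 A K D *m Xe t) 0 0.
  by apply/funext => t; rewrite /f mxE.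
by move=> t; apply: cvgD; exact: continuous_mulmx.
Qed.

Let boundary : {ae mu, forall t : R, 0 <= t -> u D t = f t}.
Proof.
apply: filterS (sol_boundary sol); first exact: (ae_filter_ringOfSetsType mu).
by move=> t + t0 => /(_ t0) ->; rewrite /f /Xe /uhe !frozenE.
Qed.

Let uh_ode (t : R) j : 0 < t -> is_derive t (1 : R) (fun s => uhe s j 0)
  ((tAd A B K D N *m uhe t + tBd A K D N *m Xe t) j 0).
Proof.
move=> t0; rewrite {2}/uhe /Xe !frozenE ?ltW//.
apply: near_eq_is_derive (sol_controller sol j t0).
by near=> s; rewrite /uhe frozenE// ltW//; near: s; exact: lt_nbhsr.
Unshelve. all: by end_near. Qed.

Let L2 (t : R) : 0 <= t -> in_L2 D (u^~ t). Proof. exact: (sol_L2 sol). Qed.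

Let g_integrable (a b : R) : 0 <= a -> mu.-integrable `[a, b] (EFin \o g).
Proof.
apply: delay_line_integrable => //; apply: in_L2_integrable.
exact: (L2 0 (lexx _)).
Qed.

Let g_sqr_integrable (a b : R) : 0 <= a -> mu.-integrable `[a, b] (EFin \o (fun s => g s ^+ 2)).
Proof. by apply: delay_line_sqr_integrable => //; exact: L2. Qed.

Let energyE (t : R) : 0 <= t ->
  \int[mu]_(z in `[0, D]) u z t ^+ 2 = \int[mu]_(s in `[t, t + D]) g s ^+ 2.
Proof.
apply: profile_energy => //; first exact: (sol_trace sol).
- exact: (sol_joint sol).
- exact: (sol_transport sol).
Qed.

(** The plant meets [u 0] only under an integral, where it can be exchanged for the almost
    everywhere equal [g]. *)
Let plant : integrated_plant n A B Xe g.
Proof.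
move=> t i t0; rewrite /Xe !frozenE//.
have [iu _ ->] := sol_plant sol t0; last by rewrite t0 lexx.
congr (_ + _).
have cAX : continuous (fun s => (A *m Xe s) i 0) by exact: continuous_mulmx.
transitivity (\int[mu]_(s in `[0, t]) ((A *m Xe s) i 0 + u 0 s * B i 0)).
  apply: eq_Rintegral => s; rewrite inE/= in_itv/= => /andP[s0 _].
  by rewrite mxE [X in _ + X]mxE /Xe frozenE.
transitivity (\int[mu]_(s in `[0, t]) ((A *m Xe s) i 0 + g s * B i 0)); last first.
  by apply: eq_Rintegral => s _; rewrite [RHS]mxE; congr (_ + _); rewrite mxE.
have mA : measurable_fun `[0, t] (fun s => (A *m Xe s) i 0).
  by apply: measurable_funTS; exact: continuous_measurable_fun.
have mu0 : measurable_fun `[0, t] (u 0) by move/integrableP : iu => [/measurable_EFinP].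
have mg : measurable_fun `[0, t] g.
  by move/integrableP : (g_integrable 0 t (lexx _)) => [/measurable_EFinP].
apply: ae_eq_Rintegral_itv.
- by apply: measurable_funD => //; apply: measurable_funM.
- by apply: measurable_funD => //; apply: measurable_funM.
have out := outflow_eq_delay_line D u f D_gt0 L2 (sol_trace sol) (sol_joint sol)
  (sol_transport sol) f_continuous boundary t t0.
apply: filterS out; first exact: (ae_filter_ringOfSetsType mu).
by move=> s + st => /(_ st) ->.
Qed.

(** Beyond [D] the integral of the input is the constant [gD] plus a primitive of the continuous
    [f], so the integrated plant equation can be differentiated at every time. *)
Let X_ode (t : R) i : D < t -> is_derive t (1 : R) (fun s => Xe s i 0)
  ((A *m Xe t + f (t - D) *: B) i 0).
Proof.
move=> Dt; have cAX : continuous (fun s => (A *m Xe s) i 0) by exact: continuous_mulmx.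
pose gD := \int[mu]_(s in `[0, D]) g s.
have XE s : D <= s -> Xe s i 0 = Xe 0 i 0 + (\int[mu]_(r in `[0, s]) (A *m Xe r) i 0 +
    B i 0 * (gD + \int[mu]_(r in `[0, s - D]) f r)).
  move=> Ds; have s0 : 0 <= s by rewrite (le_trans (ltW D_gt0)).
  rewrite plant//; congr (_ + _).
  transitivity (\int[mu]_(r in `[0, s]) ((A *m Xe r) i 0 + B i 0 * g r)).
    by apply: eq_Rintegral => r _; rewrite mxE [X in _ + X]mxE mulrC.
  have ig := g_integrable 0 s (lexx _).
  rewrite RintegralD//; [|exact: continuousT_integrable_itv|]; last first.
    by apply: eq_integrable (integrableZl _ (B i 0) ig).
  rewrite RintegralZl//; congr (_ + _ * _).
  rewrite (@Rintegral_itv_split _ 0 D s)//; last exact: ltW.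
  by rewrite (delay_line_late D (u^~ 0) f D_gt0
    (in_L2_integrable D _ (L2 0 (lexx _))) f_continuous D s (lexx _) Ds) subrr.
have d1 := is_derive_primitive 0 _ t cAX (lt_trans D_gt0 Dt).
have tD : 0 < t - D by rewrite subr_gt0.
have d2 : is_derive t (1 : R) (fun s => \int[mu]_(r in `[0, s - D]) f r) (f (t - D)).
  have := is_derive1D id (cst (- D)) t 1 0 (is_derive_id _ _) (is_derive_cst _ _ _).
  rewrite addr0 => d.
  have := @is_derive1_comp R (fun x => \int[mu]_(r in `[0, x]) f r) (fun s => s - D) t
    (f (t - D)) 1 (is_derive_primitive 0 f _ f_continuous tD) d.
  by rewrite mulr1.
have d3 := is_derive1D _ _ _ _ _ (is_derive_cst (Xe 0 i 0) t (1 : R))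
  (is_derive1D _ _ _ _ _ d1 (is_derive1Z _ _ (B i 0) _
    (is_derive1D _ _ _ _ _ (is_derive_cst gD t (1 : R)) d2))).
have d4 : is_derive t (1 : R) (fun s => Xe s i 0) (0 + ((A *m Xe t) i 0 + B i 0 * (0 + f (t - D)))).
  apply: near_eq_is_derive d3; near=> s.
  have Ds : D < s by near: s; exact: lt_nbhsr.
  by rewrite (XE s (ltW Ds)).
apply: (is_derive_eq d4); rewrite [RHS]mxE !add0r; congr (_ + _).
by rewrite [RHS]mxE mulrC.
Unshelve. all: by end_near. Qed.

Lemma frozen_early_trajectory :
  early_trajectory n N A B (tAd A B K D N) (tBd A K D N) D Xe uhe g.
Proof.
split; [by []|exact: g_integrable|exact: g_sqr_integrable|exact: plant|].
by move=> t j t0; exact: uh_ode.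
Qed.

Lemma frozen_late_trajectory : late_trajectory n N A B K D Xe uhe (fun s => f (s - D)).
Proof.
split; [by []|exact: continuous_shiftr|exact: X_ode| |].
  by move=> t j Dt; apply: uh_ode; exact: lt_trans Dt.
by move=> t Dt; rewrite addrAC subrr add0r.
Qed.

Let f_sqr_continuous : continuous (fun s => f s ^+ 2).
Proof.
move=> s; apply: (@continuous_comp _ _ _ f (fun y : R => y ^+ 2)).
  exact: f_continuous.
exact: exprn_continuous.
Qed.

Let initial_sqr_integrable : mu.-integrable `[0, D] (EFin \o (fun z => u z 0 ^+ 2)).
Proof. by have [] := L2 0 (lexx _). Qed.

Lemma initial_energyE :
  \int[mu]_(s in `[0, D]) g s ^+ 2 = \int[mu]_(z in `[0, D]) u z 0 ^+ 2.
Proof. by rewrite energyE// add0r. Qed.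

(** The window [[t, t + D]] is cut at [D]: below lies what remains of the initial profile, above
    lies the feedback issued during [[0, t]], whose square is at most [k * M]. *)
Lemma early_profile_energy_le (k M t : R) : 0 <= k -> 0 <= M ->
  (forall x y, (K1 A B K D N *m y + K2 A K D *m x) 0 0 ^+ 2 <= k * (sqnorm x + sqnorm y)) ->
  (forall s, 0 <= s <= D -> sqnorm (X s) + sqnorm (uh s) <= M) ->
  0 <= t <= D ->
  \int[mu]_(z in `[0, D]) u z t ^+ 2 <=
    \int[mu]_(z in `[0, D]) u z 0 ^+ 2 + D * (k * M).
Proof.
move=> k0 M0 hk hM /andP[t0 tD].
rewrite energyE// (@Rintegral_itv_split _ t D (t + D))//; last 2 first.
- by rewrite lerDr.
- exact: g_sqr_integrable.
apply: lerD.
  rewrite -initial_energyE (@Rintegral_itv_split _ 0 t D)//; last exact: g_sqr_integrable.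
  by rewrite lerDr; apply: Rintegral_ge0 => s _; exact: sqr_ge0.
rewrite delay_lineX delay_line_late ?lerDr// subrr addrK.
apply: (@le_trans _ _ (\int[mu]_(s in `[0, t]) (k * M))).
  apply: le_Rintegral => //; [exact: continuousT_integrable_itv| |].
    by apply: continuousT_integrable_itv; exact: cst_continuous.
  move=> s; rewrite /= in_itv/= => /andP[s0 st].
  rewrite (le_trans (hk _ _))// ler_wpM2l// /Xe /uhe !frozenE// hM//.
  by rewrite s0 (le_trans st).
rewrite Rintegral_cst// mulrC ler_wpM2r ?mulr_ge0//= lebesgue_measure_itv/= lte_fin.
by case: ifP => _ /=; rewrite ?subr0// ltW.
Qed.

Lemma late_state_energyE s : D <= s ->
  state_energy X uh u s = window_energy n N D Xe uhe (fun r => f (r - D)) s.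
Proof.
move=> Ds; have s0 : 0 <= s by rewrite (le_trans (ltW D_gt0)).
rewrite /state_energy /window_energy /Xe /uhe !frozenE//; congr (_ + _).
rewrite energyE// delay_lineX delay_line_late ?lerDl ?(ltW D_gt0)//.
have cw2 := @continuous_shiftr R (fun r => f r ^+ 2) (- D) f_sqr_continuous.
rewrite (@Rintegral_shift R s 0 D (fun r => f (r - D) ^+ 2)); last first.
  exact: continuousT_integrable_itv.
rewrite add0r [D + s]addrC (@Rintegral_shift R (- D) s (s + D) (fun r => f r ^+ 2))//.
exact: continuousT_integrable_itv.
Qed.

End Trajectory.

Lemma state_energy_ge0 X uh u t : 0 <= state_energy X uh u t.
Proof.
by rewrite !addr_ge0 ?sqnorm_ge0//; apply: Rintegral_ge0 => z _; exact: sqr_ge0.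
Qed.

Lemma closed_loop_decay (l : nat) (P : 'M[R]_(n + N + l)) (alpha : R) :
  posdef P -> 0 < alpha -> negdef (Lambda A B K D P alpha) ->
  exists C c : R, [/\ 0 < C, 0 < c &
    forall X uh u, closed_loop_solution A B K D X uh u ->
    forall t : R, 0 <= t ->
      state_energy X uh u t <= C * expR (- (c * t)) * state_energy X uh u 0].
Proof.
move=> P0 al0 L0.
have [C1 [c [C10 c0 late]]] := late_decay n N l A B K D D_gt0 P alpha P0 al0 L0.
have [C2 C20 early] := early_bound n N A B (tAd A B K D N) (tBd A K D N) D D_gt0.
have [k1 k10 k1E] := sqnorm_mulmx_le (K1 A B K D N).
have [k2 k20 k2E] := sqnorm_mulmx_le (K2 A K D).
pose k := 2 * (k1 + k2).
have k0 : 0 <= k by rewrite /k; lra.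
have kE x y : (K1 A B K D N *m y + K2 A K D *m x) 0 0 ^+ 2 <= k * (sqnorm x + sqnorm y).
  apply: (le_trans (sqnorm_coord _ _)); apply: (le_trans (sqnormD _ _)).
  have := k1E y; have := k2E x; have := sqnorm_ge0 x; have := sqnorm_ge0 y.
  rewrite /k; nra.
(* The three terms bound, on [[0, D]], the finite-dimensional states, the remnant of the initial
   profile, and the feedback already fed into the line. *)
pose C3 := C2 + 1 + D * k * C2.
have C31 : 1 <= C3.
  have DkC : 0 <= D * k * C2 := mulr_ge0 (mulr_ge0 (ltW D_gt0) k0) C20.
  by rewrite /C3; lra.
(* The exponential compensates for [expR (- (c * t))] as long as [t <= D] and restarts the clock at
   [D] afterwards. [C1] is only known to be nonnegative; [C1 + 1] is at least 1, as the early phase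
   requires. *)
exists ((C1 + 1) * C3 * expR (c * D)), c; split => //.
  by rewrite !mulr_gt0 ?expR_gt0//; lra.
move=> X uh u sol t t0.
pose E s := state_energy X uh u s; rewrite -!/(E _).
have E0 s : 0 <= E s by exact: state_energy_ge0.
have bnd s : 0 <= s <= D -> sqnorm (X s) + sqnorm (uh s) <= C2 * E 0.
  move=> sD; have s0 : 0 <= s by case/andP: sD.
  have := early _ _ _ (frozen_early_trajectory _ _ _ sol) s sD.
  by rewrite !frozenE// (initial_energyE _ _ _ sol).
have hE s : 0 <= s <= D -> E s <= C3 * E 0.
  move=> sD; have CE : 0 <= C2 * E 0 by rewrite mulr_ge0.
  have := early_profile_energy_le _ _ _ sol k (C2 * E 0) s k0 CE kE bnd sD.
  have : \int[mu]_(z in `[0, D]) u z 0 ^+ 2 <= E 0.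
    by rewrite /E /state_energy lerDr addr_ge0// sqnorm_ge0.
  move: (\int[mu]_(z in `[0, D]) u z 0 ^+ 2) => p pE qE.
  have -> : C3 * E 0 = C2 * E 0 + (E 0 + D * (k * (C2 * E 0))) by rewrite /C3; ring.
  by rewrite lerD ?bnd// (le_trans qE)// lerD.
rewrite -[(C1 + 1) * C3 * _ * _]mulrA -expRD -mulrBr.
have [tD|/ltW Dt] := leP t D.
  have e1 : 1 <= expR (c * (D - t)).
    by rewrite -expR0 ler_expR mulr_ge0 ?subr_ge0// ltW.
  rewrite (le_trans (hE t _)) ?t0//.
  have CE : 0 <= C3 * E 0 by rewrite mulr_ge0//; lra.
  rewrite mulrAC -[leLHS]mulr1 ler_pM// -mulrA -[leLHS]mul1r ler_wpM2r//; lra.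
have := late _ _ _ (frozen_late_trajectory _ _ _ sol) t Dt.
rewrite -!(late_state_energyE _ _ _ sol)// -!/(E _) => /le_trans; apply.
rewrite mulNr -mulrN opprB -!mulrA ler_pM//.
- by rewrite mulr_ge0// expR_ge0.
- lra.
rewrite mulrCA ler_wpM2l ?expR_ge0// hE// lexx andbT ltW//.
Qed.

End ClosedLoopEstimate.

Theorem theorem1 (R : realType) (n : nat) (D : R)
    (A : 'M[R]_n) (B : 'cV[R]_n) (K : 'rV[R]_n) (N : nat)
    (n_ge1 : (1 <= n)%N) (D_gt0 : 0 < D)
    (AB_controllable : controllable A B)
    (ABK_hurwitz : hurwitz (A + B *m K))
    (N_gt1 : (1 < N)%N) :
  (exists (l : nat) (P : 'M[R]_(n + N + l)) (alpha : R),
     [/\ (1 <= l)%N, P^T = P, posdef P, 0 < alpha &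
         negdef (Lambda A B K D P alpha)]) ->
  asymptotically_stable A B K D N.
Proof.
move=> [l [P [alpha [_ _ P0 al0 L0]]]].
have [C [c [C0 c0 decay]]] := closed_loop_decay n N A B K D D_gt0 l P alpha P0 al0 L0.
have normE X uh u t : state_norm D (X t) (uh t) (fun z => u z t) =
    Num.sqrt (state_energy n N D X uh u t) by [].
split=> [eps eps0|X uh u sol].
  (* The decay estimate concerns the squared norm, hence the square root of [C]. *)
  exists (eps / Num.sqrt C); first by rewrite divr_gt0 ?sqrtr_gt0.
  move=> X uh u sol; rewrite !normE ltr_pdivlMr ?sqrtr_gt0//.
  rewrite -sqrtrM ?state_energy_ge0// => small t t0.
  rewrite normE (le_lt_trans _ small)// ler_sqrt ?mulr_ge0 ?state_energy_ge0 ?(ltW C0)//.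
  rewrite (le_trans (decay _ _ _ sol t t0))// mulrC ler_wpM2l ?state_energy_ge0//.
  by rewrite -[leRHS]mulr1 ler_wpM2l ?(ltW C0)// -expR0 ler_expR oppr_le0 mulr_ge0// ltW.
apply/cvgr0Pnorm_lt => eps eps0.
pose M := C * state_energy n N D X uh u 0.
have M0 : 0 <= M by rewrite mulr_ge0 ?state_energy_ge0// ltW.
near=> t.
have t0 : 0 < t by near: t; exact: nbhs_pinfty_gt.
(* By [1 + c * t <= expR (c * t)], this threshold already forces [M < eps ^+ 2 * expR (c * t)]. *)
have tM : M / eps ^+ 2 / c < t.
  by near: t; apply: nbhs_pinfty_gt; exact: num_real.
rewrite normE ger0_norm ?sqrtr_ge0// -[ltRHS]ger0_norm ?(ltW eps0)// -sqrtr_sqr.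
rewrite ltr_sqrt ?exprn_gt0// (le_lt_trans (decay _ _ _ sol t (ltW t0)))//.
rewrite mulrAC expRN -/M ltr_pdivrMr ?expR_gt0//.
move: tM; rewrite ltr_pdivrMr// ltr_pdivrMr ?exprn_gt0// => tM.
rewrite (lt_le_trans tM)// mulrC ler_wpM2l ?sqr_ge0// mulrC.
by apply: le_trans (expR_ge1Dx _); rewrite lerDr.
Unshelve. all: by end_near. Qed.
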